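(* Let $G$ be a simple graph on $n$ vertices and let $H$ be a minor of $G$ such that every non-trivial token graph of $H$ is non-planar, i.e. $F_j(H)$ is non-planar for every integer $j$ with $2\le j\le |V(H)|-2$. Then $F_k(G)$ is non-planar for every integer $k$ with $2\le k\le n-2$.
   Context: For a simple graph $G=(V,E)$ on $n$ vertices and an integer $1\le k<n$, the $k$-token graph $F_k(G)$ is the graph whose vertices are all $k$-element subsets of $V$, two such subsets $A,B$ being adjacent whenever their symmetric difference $A\triangle B$ is a pair $\{a,b\}$ with $a$ adjacent to $b$ in $G$. The token graphs $F_1(G)$ and $F_{n-1}(G)$ (both isomorphic to $G$) are called trivial; the others are non-trivial. A graph $H$ is a minor of $G$ if a graph isomorphic to $H$ can be obtained from $G$ by contracting edges, deleting edges, and deleting vertices.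
   Formalization: The formal statement additionally assumes that H has at least 4 vertices; otherwise the hypothesis on H is vacuous and the claim fails (H = K_1 is a minor of K_4, but F_2(K_4) is the planar octahedron). *)

(* Defs.v *)
From HB Require Import structures.
From mathcomp Require Import all_boot all_order all_algebra.

Set Implicit Arguments.
Unset Strict Implicit.
Unset Printing Implicit Defensive.

Import Order.TTheory GRing.Theory Num.Theory.

(* A simple graph is a symmetric irreflexive relation [e : rel T] on a finType T
   (vertex set T, n = #|T|). *)

Definition token_vertex (T : finType) (k : nat) := {A : {set T} | #|A| == k}.

Definition token_graph (T : finType) (e : rel T) (k : nat) : rel (token_vertex T k) :=
  fun A B => [exists a : T, exists b : T,
    e a b && (((val A :\: val B) :|: (val B :\: val A)) == [set a; b])].

Definition induced (T : finType) (e : rel T) (S : {set T}) : rel T :=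
  fun x y => [&& e x y, x \in S & y \in S].

Definition is_minor (U T : finType) (h : rel U) (e : rel T) : Prop :=
  exists B : U -> {set T},
    [/\ (forall u, B u != set0),
        (forall u v, u != v -> [disjoint B u & B v]),
        (forall u x y, x \in B u -> y \in B u -> connect (induced e (B u)) x y) &
        (forall u v, h u v -> exists x y, [/\ x \in B u, y \in B v & e x y])].

From mathcomp Require Import all_classical all_reals all_analysis.
From mathcomp Require Import Rstruct Rstruct_topology.

Local Open Scope ring_scope.

Definition plane := (Rdefinitions.R * Rdefinitions.R)%type.

Definition arc (g : Rdefinitions.R -> plane) : Prop :=
  {within `[0%R, 1%R], continuous g}%classic /\
  (forall s t : Rdefinitions.R, 0 <= s <= 1 -> 0 <= t <= 1 -> g s = g t -> s = t).

Definition planar (V : finType) (r : rel V) : Prop :=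
  exists (p : V -> plane) (g : V -> V -> Rdefinitions.R -> plane),
    [/\ injective p,
        (forall x y, r x y ->
           [/\ arc (g x y), g x y 0 = p x, g x y 1 = p y &
               forall t, 0 < t < 1 -> forall z, g x y t <> p z]) &
        (forall x y x' y', r x y -> r x' y' -> (finset.setU (finset.set1 x) (finset.set1 y) != finset.setU (finset.set1 x') (finset.set1 y')) ->
           forall s t, 0 < s < 1 -> 0 < t < 1 -> g x y s <> g x' y' t)].

Arguments token_graph {T} e k.
Arguments planar {V} r.
Arguments is_minor {U T} h e.

(* Main.v *)
Require Import Defs.
From mathcomp Require Import all_boot.

(** A drawing in the plane stays a drawing under any continuous map of the plane
which identifies only two vertices, so an edge [ab] can be contracted as soon
as there is a set [A], meeting the rest of the drawing in [a] and [b] only, and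
a continuous map of the plane which is constant on [A] and injective elsewhere.
For a segment such a map is an explicit shear supported in a thin kite around
the segment.  Composing these maps handles a simple polygonal path built segment
by segment, the kite of each new segment meeting the previous path in one point
only.  Such a path exists next to every edge [ab] once the drawing is radial near
[a] and [b], which is achieved by replacing what precedes the last exit from a
small disc by a radius.  Hence planarity passes to minors.

If [H] is a minor of [G], then some [F_j(H)] is a minor of [F_k(G)]: freeze
[k - j] tokens off a transversal of the branch sets, and simulate a [j]-subset
[J] of [V(H)] by one additional token in each branch set indexed by [J]. *)

Set Implicit Arguments.
Unset Strict Implicit.
Unset Printing Implicit Defensive.

(** * Token graphs and minors *)

Section TokenSwap.
Variable T : finType.
Implicit Types (A C : {set T}) (x y z : T).

Definition swap A x y : {set T} := y |: A :\ x.

Lemma card_swap A x y : x \in A -> y \notin A -> #|swap A x y| = #|A|.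
Proof.
by move=> xA yA; rewrite cardsU1 !inE (negbTE yA) andbF (cardsD1 x A) xA.
Qed.

Lemma swapI A C x y : x \in C -> y \in C -> swap A x y :&: C = swap (A :&: C) x y.
Proof.
move=> xC yC; apply/setP => z; rewrite !inE.
by have [->|_] := eqVneq z y; rewrite ?yC //= andbA.
Qed.

Lemma swapI_out A C x y : x \notin C -> y \notin C -> swap A x y :&: C = A :&: C.
Proof.
move=> xC yC; apply/setP => z; rewrite !inE.
have [->|_] := eqVneq z y; first by rewrite (negbTE yC) !andbF.
by have [->|_] := eqVneq z x; rewrite ?(negbTE xC) ?andbF.
Qed.

Lemma swap_trans A x y z : x \in A -> y \notin A -> z \notin A -> y != z ->
  swap (swap A x y) y z = swap A x z.
Proof.
move=> xA yA zA yz; apply/setP => w; rewrite !inE.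
have [//|wz] := eqVneq w z; rewrite /=.
by have [->|wy] := eqVneq w y; rewrite //= (negbTE yA) andbF.
Qed.

(** Tokens are indistinguishable: sending the token at [y] on to [z] and refilling [y] from [x]
    carries a token past an occupied vertex. *)
Lemma swap_comm A x y z : x \in A -> y \in A -> z \notin A -> x != y ->
  swap (swap A y z) x y = swap A x z.
Proof.
move=> xA yA zA xy; apply/setP => w; rewrite !inE.
have [->|wy] := eqVneq w y; first by rewrite yA eq_sym xy orbT.
have [->|wz] := eqVneq w z; last by [].
by rewrite andbT; apply: contraTneq xA => <-.
Qed.

End TokenSwap.

(** The adjacency of [token_graph] on bare sets, so that moves can be studied before sizes are
    packed into the subtype. *)
Definition token_move (T : finType) (e : rel T) : rel {set T} := fun A C =>
  [exists a : T, exists b : T, e a b && ((A :\: C) :|: (C :\: A) == [set a; b])].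

Lemma token_move_swap (T : finType) (e : rel T) (A : {set T}) x y :
  e x y -> x \in A -> y \notin A -> token_move e A (swap A x y).
Proof.
move=> exy xA yA; apply/existsP; exists x; apply/existsP; exists y.
have xy : x != y by apply: contraNneq yA => <-.
rewrite exy; apply/eqP/setP => z; rewrite !inE.
have [->|zx] := eqVneq z x; first by rewrite xA (negbTE xy).
have [->|zy] := eqVneq z y; first by rewrite yA.
by rewrite /=; case: (z \in A).
Qed.

(** * Simulating a token graph of the minor *)

Section TokenMinor.
Variables (T U : finType) (e : rel T) (h : rel U) (B : U -> {set T}).
Hypotheses (hC : symmetric h)
  (Bdisj : forall u v, u != v -> [disjoint B u & B v])
  (Bconn : forall u x y, x \in B u -> y \in B u -> connect (induced e (B u)) x y)
  (Bedge : forall u v, h u v -> exists x y, [/\ x \in B u, y \in B v & e x y]).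
Variables (j k : nat) (D : {set T}).
Hypotheses (Dfree : forall u, exists2 x, x \in B u & x \notin D)
  (Dk : #|D| + j = k).

Lemma branch_uniq u v x : x \in B u -> x \in B v -> u = v.
Proof.
move=> xu xv; apply/eqP; apply: contraT => /Bdisj /pred0P/(_ x) /=.
by rewrite xu xv.
Qed.

(* [D] is a set of frozen tokens; a configuration [J] on the minor is simulated by
   putting one token more than [D] does in the branch sets indexed by [J]. *)
Definition simulates (J : {set U}) (A : {set T}) : bool :=
  [&& #|A| == k, A :\: (\bigcup_u B u) == D :\: (\bigcup_u B u) &
      [forall u, #|A :&: B u| == #|D :&: B u| + (u \in J)]].

Lemma simulates_swap J A u x y : simulates J A -> x \in B u -> y \in B u ->
  x \in A -> y \notin A -> simulates J (swap A x y).
Proof.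
move=> /and3P[/eqP Ak /eqP Ao /forallP AB] xu yu xA yA; apply/and3P; split.
- by rewrite card_swap ?Ak.
- rewrite -Ao !setDE swapI_out // inE negbK; by apply/bigcupP; exists u.
- apply/forallP => v; rewrite -(eqP (AB v)); have [->|vu] := eqVneq v u.
    by rewrite swapI // card_swap // !inE ?xA ?(negbTE yA).
  by rewrite swapI_out //; apply: contraNN vu => /branch_uniq E; apply/eqP; exact: E.
Qed.

Definition sim_move (J : {set U}) : rel {set T} := fun A C =>
  [&& token_move e A C, simulates J A & simulates J C].

(** Induction along a path from [x] to [y] inside the branch set. If the next vertex [z] is free,
    the token steps there and goes on. If it is occupied, the token at [z] first travels to [y], and
    then the one at [x] steps to [z]. *)
Lemma sim_connect_swap J A u x y : simulates J A -> x \in B u -> y \in B u ->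
  x \in A -> y \notin A -> connect (sim_move J) A (swap A x y).
Proof.
move=> + xu yu; have /connectP[s] := Bconn xu yu.
elim: s x xu A => [|z s IH] x xu A /=; first by move=> _ -> _ ->.
move=> /andP[/and3P[exz _ zu] zs] yE sA xA yA.
have [zA|zA] := boolP (z \in A).
  have [->|xz] := eqVneq x z; first exact: IH.
  have zy : z != y by apply: contraNneq yA => <-.
  apply: (connect_trans (IH z zu A zs yE sA zA yA)).
  have sA' := simulates_swap sA zu yu zA yA.
  have xA' : x \in swap A z y by rewrite !inE xA xz orbT.
  have zA' : z \notin swap A z y by rewrite !inE eqxx orbF.
  rewrite -(swap_comm xA zA yA xz); apply: connect1.
  by rewrite /sim_move token_move_swap // sA' (simulates_swap sA' xu zu).
have sA' := simulates_swap sA xu zu xA zA.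
apply: (@connect_trans _ _ (swap A x z)).
  by apply: connect1; rewrite /sim_move token_move_swap // sA.
have [<-|zy] := eqVneq z y; first exact: connect0.
rewrite -(swap_trans xA zA yA zy); apply: IH => //.
  by rewrite !inE eqxx.
by rewrite !inE eq_sym (negbTE zy) (negbTE yA) andbF.
Qed.

(** Induction on [#|A :\: C|]. A token at [x] in [A] but not in [C] lies in a branch set, since off
    these both sets agree with [D]. Equal counts there yield a [y] in [C] but not in [A], and moving
    [x] to [y] shrinks the difference. *)
Lemma sim_connect J A C : simulates J A -> simulates J C ->
  connect (sim_move J) A C.
Proof.
have [n] := ubnP #|A :\: C|; elim: n => // n IH in A *.
move=> An sA sC; have /and3P[/eqP Ak /eqP Ao /forallP AB] := sA.
have /and3P[/eqP Ck /eqP Co /forallP CB] := sC.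
have [AC|/set0Pn[x]] := eqVneq (A :\: C) set0.
  suff -> : A = C by exact: connect0.
  by apply/eqP; rewrite eqEcard Ak Ck leqnn andbT -setD_eq0 AC.
rewrite !inE => /andP[xC xA].
have /bigcupP[u _ xu] : x \in \bigcup_u B u.
  apply: contraT => xB; have : x \in A :\: \bigcup_u B u by rewrite inE xB.
  by rewrite Ao -Co inE (negbTE xC) andbF.
have [y [yC yA yu]] : exists y, [/\ y \in C, y \notin A & y \in B u].
  have : ~~ (C :&: B u \subset A :&: B u).
    apply/negP => CA; have : C :&: B u == A :&: B u.
      by rewrite eqEcard CA (eqP (AB u)) (eqP (CB u)) leqnn.
    by move=> /eqP/setP/(_ x); rewrite !inE xA xu (negbTE xC).
  by move=> /subsetPn[y]; rewrite !inE => /andP[yC yu]; rewrite yu andbT; exists y.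
apply: (connect_trans (sim_connect_swap sA xu yu xA yA)).
apply: IH; [|exact: simulates_swap sA xu yu xA yA|exact: sC].
rewrite ltnS in An; apply: leq_trans An; apply: proper_card; apply/properP; split.
  apply/subsetP => z; rewrite !inE.
  by have [->|_] := eqVneq z y; rewrite ?yC // => /and3P[-> _ ->].
by exists x; rewrite !inE ?xC // eqxx /= orbF; apply: contraNN xC => /eqP->.
Qed.

(** The witness adds to [D] one token at an unfrozen vertex [q u] of [B u] for each [u] in [J]. *)
Lemma simulates_ex (J : {set U}) : #|J| = j -> exists A, simulates J A.
Proof.
move=> Jj; have qP u : {x | (x \in B u) && (x \notin D)}.
  by apply: sigW; have [x xu xD] := Dfree u; exists x; rewrite xu.
pose q u := sval (qP u).
have qB u : q u \in B u by case/andP: (svalP (qP u)).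
have qD u : q u \notin D by case/andP: (svalP (qP u)).
have qI : injective q by move=> u v E; apply: (branch_uniq (qB u)); rewrite E.
exists (D :|: q @: J); apply/and3P; split.
- rewrite cardsU (_ : D :&: q @: J = set0) ?cards0 ?subn0 ?card_imset ?Jj ?Dk //.
  apply/setP => x; rewrite !inE; apply/negP => /andP[xD /imsetP[u _ xE]].
  by move: (qD u); rewrite -xE xD.
- apply/eqP/setP => x; rewrite !inE; have [//|xB] := boolP (x \in \bigcup_u B u).
  have [//|xD] /= := boolP (x \in D); apply/negP => /imsetP[u _ xE].
  by case/bigcupP: xB; exists u; rewrite ?xE.
- apply/forallP => u; have [uJ|uJ] := boolP (u \in J).
    have -> : (D :|: q @: J) :&: B u = q u |: (D :&: B u).
      apply/setP => x; rewrite !inE; have [->|xq] := eqVneq x (q u).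
        by rewrite qB andbT imset_f ?orbT.
      rewrite /=; have [xu|] := boolP (x \in B u); last by rewrite !andbF.
      have [//|xD] /= := boolP (x \in D); rewrite andbT.
      apply/negP => /imsetP[v _ xE]; case/negP: xq; rewrite xE; apply/eqP.
      by congr q; apply: (@branch_uniq _ _ x) => //; rewrite xE.
    by rewrite cardsU1 !inE (negbTE (qD u)) addnC.
  suff -> : (D :|: q @: J) :&: B u = D :&: B u by rewrite addn0.
  apply/setP => x; rewrite !inE; have [xu|] := boolP (x \in B u); last by rewrite !andbF.
  rewrite !andbT; have [//|xD] /= := boolP (x \in D).
  apply/negP => /imsetP[v vJ xE]; case/negP: uJ.
  by rewrite (@branch_uniq u v x) // xE.
Qed.

Lemma simulates_disjoint J J' A : simulates J A -> simulates J' A -> J = J'.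
Proof.
move=> /and3P[_ _ /forallP AJ] /and3P[_ _ /forallP AJ']; apply/setP => u.
have := AJ u; rewrite (eqP (AJ' u)) eqn_add2l.
by case: (u \in J); case: (u \in J').
Qed.

(** A move of [J] carries a token from [c] to [d]. It is imitated along an edge [x y] between [B c]
    and [B d], after rearranging the tokens within these two sets so that [x] is occupied and [y] is
    free. *)
Lemma sim_edge (J J' : {set U}) : #|J| = j -> #|J'| = j -> token_move h J J' ->
  exists A A', [/\ simulates J A, simulates J' A' & token_move e A A'].
Proof.
move=> Jj J'j /existsP[a /existsP[b /andP[hab /eqP JJ']]].
have cardD : #|J :\: J'| = #|J' :\: J| by rewrite !cardsD Jj J'j setIC.
(* The two differences are disjoint, have equal size and together form a pair, so each is a
   singleton; symmetry of [h] orients the edge. *)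
have [c [d [cJ dJ' hcd JE]]] : exists c d,
    [/\ c \in J :\: J', d \in J' :\: J, h c d & (J :\: J') :|: (J' :\: J) = [set c; d]].
  have J0 : J :\: J' != set0.
    apply/negP => /eqP J0; have := cardD; rewrite J0 cards0 => /esym/eqP.
    rewrite cards_eq0 => /eqP J'0; move: JJ'; rewrite J0 J'0 setU0.
    by move=> /setP/(_ a); rewrite !inE eqxx.
  have J'0 : J' :\: J != set0 by rewrite -cards_eq0 -cardD cards_eq0.
  have /set0Pn[c cJ] := J0; have /set0Pn[d dJ] := J'0.
  have : c \in [set a; b] by rewrite -JJ' inE cJ.
  have : d \in [set a; b] by rewrite -JJ' inE dJ orbT.
  have cd : c != d.
    by apply/eqP => cdE; move: cJ dJ; rewrite cdE !inE => /andP[_ dJ1]; rewrite dJ1.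
  rewrite !inE => /orP[]/eqP dE /orP[]/eqP cE; rewrite ?dE ?cE ?eqxx in cd *.
  - by [].
  - by exists c, d; split; rewrite // cE dE ?JJ' 1?hC // setUC.
  - by exists c, d; split; rewrite // cE dE.
  - by [].
have Jother u : u != c -> u != d -> (u \in J') = (u \in J).
  move=> uc ud; have /setP/(_ u) := JE; rewrite !inE (negbTE uc) (negbTE ud).
  by case: (u \in J); case: (u \in J').
move: cJ dJ'; rewrite !inE => /andP[cJ' cJ] /andP[dJ dJ'].
have cd : c != d by apply: contraNneq dJ => <-.
have [x [y [xc yd exy]]] := Bedge hcd.
have [A0 s0] := simulates_ex Jj.
(* Since [c] is in [J], the set [B c] holds at least one token, which can be brought to [x]. *)
have [A1 s1 x1] : exists2 A, simulates J A & x \in A.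
  have [xA|xA] := boolP (x \in A0); first by exists A0.
  have /and3P[_ _ /forallP/(_ c)] := s0; rewrite cJ addn1 => /eqP cardc.
  have /set0Pn[z] : A0 :&: B c != set0 by rewrite -cards_eq0 cardc.
  rewrite !inE => /andP[zA zc]; exists (swap A0 z x); last by rewrite !inE eqxx.
  exact: simulates_swap s0 zc xc zA xA.
have xy : x != y by apply: contraNneq cd => xyE; apply/eqP/(branch_uniq xc); rewrite xyE.
(* Since [d] is not in [J], the set [B d] holds no more tokens than [D] does there, so by [Dfree] it
   has a free vertex for the token at [y]. *)
have [A2 s2 [x2 y2]] : exists2 A, simulates J A & x \in A /\ y \notin A.
  have [yA|yA] := boolP (y \in A1); last by exists A1.
  have /and3P[_ _ /forallP/(_ d)] := s1; rewrite (negbTE dJ) addn0 => /eqP cardd.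
  have [z zd zA] : exists2 z, z \in B d & z \notin A1.
    apply/subsetPn; apply/negP => dA; have := cardd; rewrite (setIidPr dA).
    have [w wd wD] := Dfree d; move=> E; have : D :&: B d == B d.
      by rewrite eqEcard subsetIr E leqnn.
    by move=> /eqP/setP/(_ w); rewrite !inE wd (negbTE wD).
  exists (swap A1 y z); first exact: simulates_swap s1 yd zd yA zA.
  rewrite !inE x1 xy orbT eqxx orbF; split=> //.
  by apply: contraNneq zA => <-.
exists A2, (swap A2 x y); split=> //; last exact: token_move_swap.
have /and3P[/eqP Ak /eqP Ao /forallP AB] := s2; apply/and3P; split.
- by rewrite card_swap ?Ak.
- rewrite -Ao !setDE swapI_out // inE negbK; apply/bigcupP; [by exists c|by exists d].
- have xnot u : u != c -> x \notin B u.
    by apply: contraNN => xu; apply/eqP; exact: branch_uniq xu xc.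
  have ynot u : u != d -> y \notin B u.
    by apply: contraNN => yu; apply/eqP; exact: branch_uniq yu yd.
  apply/forallP => u; have := AB u; have [->|uc] := eqVneq u c.
    have -> : swap A2 x y :&: B c = (A2 :&: B c) :\ x.
      apply/setP => z; rewrite !inE; have [->|] := eqVneq z y; last by rewrite /= andbA.
      by rewrite (negbTE (ynot _ cd)) !andbF.
    by rewrite (cardsD1 x (A2 :&: B c)) !inE x2 xc cJ (negbTE cJ') addnC eqn_add2r addn0.
  have [->|ud] := eqVneq u d.
    have -> : swap A2 x y :&: B d = y |: (A2 :&: B d).
      apply/setP => z; rewrite !inE; have [->|] := eqVneq z y; first by rewrite yd.
      have [->|] := eqVneq z x; last by [].
      by rewrite (negbTE (xnot d _)) 1?eq_sym // !andbF.
    by rewrite cardsU1 !inE (negbTE y2) dJ' (negbTE dJ) addn0 addnC eqn_add2r.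
  by rewrite swapI_out ?xnot ?ynot // Jother.
Qed.

(** The branch set of [J] consists of the [k]-sets simulating [J]. *)
Lemma token_minor : is_minor (token_graph h j) (token_graph e k).
Proof.
exists (fun J => [set A | simulates (val J) (val A)]); split.
- move=> J; have [A sA] := simulates_ex (eqP (valP J)); apply/set0Pn.
  have Ak : #|A| == k by case/and3P: sA.
  by exists (Sub A Ak); rewrite inE.
- move=> J J' JJ'; apply/pred0P => A /=; rewrite !inE; apply: contraNF JJ'.
  by move=> /andP[sA /(simulates_disjoint sA) E]; apply/eqP/val_inj.
- move=> J A C; rewrite !inE => sA sC.
  (* The default [A] never occurs on the path: all sets there simulate [J], so they have size
     [k]. *)
  pose f X : token_vertex T k := insubd A X.
  have fK X : simulates (val J) X -> val (f X) = X.
    by move=> /and3P[Xk _ _]; rewrite insubdK.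
  have <- : f (val A) = A by apply: val_inj; rewrite fK.
  have <- : f (val C) = C by apply: val_inj; rewrite fK.
  have /connectP[s] := sim_connect sA sC.
  elim: s (val A) {sA} => [|Y s IH] X /=; first by move=> _ ->.
  move=> /andP[/and3P[XY sX sY] /IH{}IH] /IH; apply: connect_trans.
  apply: connect1; rewrite /induced !inE !fK // sX sY !andbT.
  by rewrite /token_graph !fK.
- move=> J J' JJ'.
  have [A [A' [sA sA' AA']]] := sim_edge (eqP (valP J)) (eqP (valP J')) JJ'.
  have Ak : #|A| == k by case/and3P: sA.
  have Ak' : #|A'| == k by case/and3P: sA'.
  by exists (Sub A Ak), (Sub A' Ak'); rewrite !inE.
Qed.

End TokenMinor.

Lemma token_graph_sym (T : finType) (e : rel T) k :
  symmetric e -> symmetric (token_graph e k).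
Proof.
move=> eC A C; rewrite /token_graph; apply/existsP/existsP.
all: by move=> [a /existsP[b E]]; exists a; apply/existsP; exists b; rewrite setUC.
Qed.

Lemma token_graph_irr (T : finType) (e : rel T) k : irreflexive (token_graph e k).
Proof.
move=> A; apply/negbTE/negP => /existsP[a /existsP[b /andP[_ /eqP/setP/(_ a)]]].
by rewrite !inE eqxx; case: (a \in val A).
Qed.

Lemma minor_token (T U : finType) (e : rel T) (h : rel U) k :
  symmetric h -> is_minor h e -> 4 <= #|U| -> 2 <= k <= #|T| - 2 ->
  exists2 j, 2 <= j <= #|U| - 2 & is_minor (token_graph h j) (token_graph e k).
Proof.
move=> hC [B [B0 Bd Bc Be]] U4 /andP[k2 kT].
have qP u : {x | x \in B u} by apply: sigW; exact/set0Pn.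
pose q u := sval (qP u); have qB u : q u \in B u := svalP (qP u).
have qI : injective q.
  by move=> u v E; apply: (branch_uniq Bd (qB u)); rewrite E.
pose X := q @: [set: U]; have Xm : #|X| = #|U| by rewrite card_imset ?cardsT.
have Xn : #|~: X| = #|T| - #|U| by rewrite -Xm -(cardsC X) addKn.
have UT : #|U| <= #|T| by rewrite -Xm max_card.
(* The least [j >= 2] for which [k - j] frozen tokens fit on the [#|T| - #|U|] vertices off the
   transversal. It is at most [#|U| - 2] because [k <= #|T| - 2] and [4 <= #|U|]. *)
pose j := maxn 2 (k - (#|T| - #|U|)).
have jk : j <= k by rewrite geq_max k2 leq_subr.
have /card_geqP[s [us sk sX]] : k - j <= #|~: X|.
  by rewrite Xn leq_subCl; exact: leq_maxr.
exists j.
  have U2 : 2 <= #|U| by exact: leq_trans U4.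
  by rewrite leq_maxl geq_max leq_subRL // U4 leq_subLR addnBA // subnK.
apply: (token_minor hC Bd Bc Be (D := [set x in s])).
  move=> u; exists (q u) => //; rewrite inE; apply/negP => /sX.
  by rewrite inE imset_f.
by rewrite cardsE (card_uniqP us) sk subnK.
Qed.

(** * Contracting edges of plane drawings *)

Module PlaneDrawing.

From mathcomp Require Import all_order all_algebra.
From mathcomp Require Import all_classical all_reals all_analysis.
From mathcomp Require Import Rstruct Rstruct_topology.
From mathcomp Require Import ring lra.
Import Order.TTheory GRing.Theory Num.Theory.
Import numFieldNormedType.Exports.
Local Open Scope ring_scope.
Local Open Scope classical_set_scope.

Local Notation RR := (Rdefinitions.R : realType).

(** * Continuity of explicit maps *)

Section Continuity.
Variables (R : realType) (T : topologicalType).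
Implicit Types (f g : T -> R) (F : T -> R * R).

Lemma cont_add f g : continuous f -> continuous g ->
  continuous (fun x => f x + g x).
Proof. by move=> cf cg x; apply: cvgD; [exact: cf|exact: cg]. Qed.

Lemma cont_opp f : continuous f -> continuous (fun x => - f x).
Proof. by move=> cf x; apply: cvgN; exact: cf. Qed.

Lemma cont_mul f g : continuous f -> continuous g ->
  continuous (fun x => f x * g x).
Proof. by move=> cf cg x; apply: cvgM; [exact: cf|exact: cg]. Qed.

Lemma cont_norm f : continuous f -> continuous (fun x => `|f x|).
Proof. by move=> cf x; apply: cvg_norm; exact: cf. Qed.

Lemma cont_max f g : continuous f -> continuous g ->
  continuous (fun x => Num.max (f x) (g x)).
Proof. by move=> cf cg x; exact: (continuous_max (cf x) (cg x)). Qed.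

Lemma cont_min f g : continuous f -> continuous g ->
  continuous (fun x => Num.min (f x) (g x)).
Proof. by move=> cf cg x; exact: (continuous_min (cf x) (cg x)). Qed.

Lemma cont_fst F : continuous F -> continuous (fun x => (F x).1).
Proof. by move=> cF x; apply: (continuous_comp (cF x)); exact: cvg_fst. Qed.

Lemma cont_snd F : continuous F -> continuous (fun x => (F x).2).
Proof. by move=> cF x; apply: (continuous_comp (cF x)); exact: cvg_snd. Qed.

Lemma cont_pair f g : continuous f -> continuous g ->
  continuous (fun x => (f x, g x)).
Proof. by move=> cf cg x; exact: (cvg_pair (cf x) (cg x)). Qed.

End Continuity.

Lemma cont_comp (T U V : topologicalType) (f : T -> U) (g : U -> V) :
  continuous f -> continuous g -> continuous (fun x => g (f x)).
Proof. by move=> cf cg x; apply: continuous_comp; [exact: cf|exact: cg]. Qed.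

Lemma cont_id (T : topologicalType) : continuous (fun x : T => x).
Proof. by move=> x. Qed.

Ltac solve_cont :=
  lazymatch goal with
  | H : (forall x, continuous_at x ?f) |- forall x, continuous_at x ?f => exact: H
  | |- forall x, continuous_at x ?f =>
    lazymatch f with
    | (fun t => t) => exact: cont_id
    | @GRing.opp _ => apply: (cont_opp (@cont_id _))
    | @fst _ _ => by move=> ?; exact: cvg_fst
    | @snd _ _ => by move=> ?; exact: cvg_snd
    | (fun t => @?a t + @?b t) => apply: cont_add; solve_cont
    | (fun t => - @?a t) => apply: cont_opp; solve_cont
    | (fun t => @?a t * @?b t) => apply: cont_mul; solve_cont
    | (fun t => `|@?a t|) => apply: cont_norm; solve_cont
    | (fun t => Num.max (@?a t) (@?b t)) => apply: cont_max; solve_cont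
    | (fun t => Num.min (@?a t) (@?b t)) => apply: cont_min; solve_cont
    | (fun t => (@?a t, @?b t)) => apply: cont_pair; solve_cont
    | (fun t => (@?a t).1) => apply: cont_fst; solve_cont
    | (fun t => (@?a t).2) => apply: cont_snd; solve_cont
    | _ => by move=> ?; exact: cvg_cst
    end
  end.

(** * Segments and compact sets in the plane *)

Section Plane.
Variable R : realType.
Local Notation P := (R * R)%type.
Implicit Types (x y z w q : P) (A B : set P).

Definition lin x y (u : R) : P :=
  (x.1 + u * (y.1 - x.1), x.2 + u * (y.2 - x.2)).

Definition seg x y : set P := [set z | exists2 u, 0 <= u <= 1 & z = lin x y u].

(** The distance is kept squared so that it is polynomial in the coordinates and [ring] applies. *)
Definition sqdist x y : R := (x.1 - y.1) * (x.1 - y.1) + (x.2 - y.2) * (x.2 - y.2).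

Lemma plane_eq x y : x.1 = y.1 -> x.2 = y.2 -> x = y.
Proof. by case: x y => [? ?] [? ?] /= -> ->. Qed.

Lemma cont_lin x y : continuous (lin x y).
Proof. rewrite /lin; solve_cont. Qed.

Lemma cont_sqdist (T : topologicalType) (f g : T -> P) :
  continuous f -> continuous g -> continuous (fun t => sqdist (f t) (g t)).
Proof. move=> cf cg; rewrite /sqdist; solve_cont. Qed.

Lemma lin0 x y : lin x y 0 = x.
Proof. by apply: plane_eq => /=; ring. Qed.

Lemma lin1 x y : lin x y 1 = y.
Proof. by apply: plane_eq => /=; ring. Qed.

Lemma seg_compact x y : compact (seg x y).
Proof.
have -> : seg x y = lin x y @` `[0, 1].
  apply/seteqP; split => z /=.
    by move=> [u u01 ->]; exists u => //=; rewrite in_itv.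
  by move=> [u]; rewrite in_itv /= => u01 <-; exists u.
apply: continuous_compact; last exact: segment_compact.
exact/continuous_subspaceT/cont_lin.
Qed.

Lemma sqdist_ge0 x y : 0 <= sqdist x y.
Proof. by rewrite addr_ge0 -?expr2 ?sqr_ge0. Qed.

Lemma sqdist_eq0 x y : sqdist x y = 0 -> x = y.
Proof.
move=> /eqP; rewrite /sqdist -!expr2 paddr_eq0 ?sqr_ge0 // !sqrf_eq0 !subr_eq0.
by move=> /andP[/eqP ? /eqP ?]; apply: plane_eq.
Qed.

Lemma sqdist_gt0 x y : x <> y -> 0 < sqdist x y.
Proof.
move=> xy; rewrite lt_neqAle sqdist_ge0 andbT eq_sym; apply/eqP => /sqdist_eq0.
exact: xy.
Qed.

Lemma sqdist_lin x y u : sqdist x (lin x y u) = u ^+ 2 * sqdist x y.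
Proof. rewrite /sqdist /lin /=; ring. Qed.

(** The squared distance attains its minimum on the compact product, and this is positive by
    disjointness. If the product is empty, any [d] will do. *)
Lemma compact_gap A B : compact A -> compact B -> A `&` B = set0 ->
  exists2 d, 0 < d & forall z w, A z -> B w -> d <= sqdist z w.
Proof.
move=> cA cB AB0.
have [[[z0 w0] [/= Az0 Bw0]]|nAB] := pselect ((A `*` B) !=set0); last first.
  by exists 1 => // z w Az Bw; case: nAB; exists (z, w).
have [||[z w]] := @compact_EVT_min _ R (fun t : P * P => sqdist t.1 t.2)
  (A `*` B) _ (compact_setX cA cB).
- by exists (z0, w0).
- apply: continuous_subspaceT; apply: cont_sqdist.
  + by move=> ?; exact: cvg_fst.
  + by move=> ?; exact: cvg_snd.
rewrite inE => -[/= Az Bw] zw.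
exists (sqdist z w).
  apply: sqdist_gt0 => zw'; suff : (A `&` B) z by rewrite AB0.
  by split=> //; rewrite zw'.
by move=> z' w' Az' Bw'; apply: (zw (z', w')); rewrite inE.
Qed.

(** Used for the last contact of a segment with a path and for the last exit of a curve from a
    disc. *)
Lemma closed_last (C : set R) (u0 v : R) : closed C -> C u0 -> u0 <= v ->
  exists2 s, C s /\ u0 <= s <= v & forall t, C t -> t <= v -> t <= s.
Proof.
move=> cC Cu0 u0v.
have cD : compact (C `&` `[u0, v]).
  by rewrite setIC; apply: compact_closedI => //; exact: segment_compact.
have [||s] := @compact_EVT_max _ R id (C `&` `[u0, v]) _ cD.
- by exists u0; split=> //=; rewrite in_itv /= lexx.
- exact/continuous_subspaceT/cont_id.
rewrite inE => -[Cs /=]; rewrite in_itv /= => suv sm.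
exists s => // t Ct tv; have [tu|ut] := leP t u0.
  by apply: le_trans tu _; case/andP: suv.
by apply: sm; rewrite inE; split => //=; rewrite in_itv /= tv ltW.
Qed.

End Plane.

(** * Collapsing one segment inside a kite *)

Section Kite.
Variable R : realType.
Local Notation P := (R * R)%type.
Implicit Types (x y z w q : P) (A B : set P) (u v a b e : R).

(** [ucoord] and [vcoord] are the coordinates in the orthogonal frame with origin [x], first axis
    [y - x] and second axis its quarter turn. The segment becomes [[0, 1]] on the first axis. *)
Definition ucoord x y z : R :=
  ((z.1 - x.1) * (y.1 - x.1) + (z.2 - x.2) * (y.2 - x.2)) * (sqdist x y)^-1.

Definition vcoord x y z : R :=
  ((z.2 - x.2) * (y.1 - x.1) - (z.1 - x.1) * (y.2 - x.2)) * (sqdist x y)^-1.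

Lemma coord_inj x y z w : x <> y ->
  ucoord x y z = ucoord x y w -> vcoord x y z = vcoord x y w -> z = w.
Proof.
move=> /sqdist_gt0/lt0r_neq0 n0 /(mulIf (invr_neq0 n0)) eu.
move=> /(mulIf (invr_neq0 n0)) ev.
apply: plane_eq; apply: (mulIf n0); apply/eqP; rewrite -subr_eq0; apply/eqP.
  (* Inverting the frame: the dot and cross products with [y - x] recombine to [sqdist x y] times a
     coordinate difference. *)
  transitivity ((y.1 - x.1) *
    ((z.1 - x.1) * (y.1 - x.1) + (z.2 - x.2) * (y.2 - x.2) -
     ((w.1 - x.1) * (y.1 - x.1) + (w.2 - x.2) * (y.2 - x.2))) -
    (y.2 - x.2) *
    ((z.2 - x.2) * (y.1 - x.1) - (z.1 - x.1) * (y.2 - x.2) -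
     ((w.2 - x.2) * (y.1 - x.1) - (w.1 - x.1) * (y.2 - x.2)))).
    by rewrite /sqdist; ring.
  by rewrite eu ev; ring.
transitivity ((y.2 - x.2) *
  ((z.1 - x.1) * (y.1 - x.1) + (z.2 - x.2) * (y.2 - x.2) -
   ((w.1 - x.1) * (y.1 - x.1) + (w.2 - x.2) * (y.2 - x.2))) +
  (y.1 - x.1) *
  ((z.2 - x.2) * (y.1 - x.1) - (z.1 - x.1) * (y.2 - x.2) -
   ((w.2 - x.2) * (y.1 - x.1) - (w.1 - x.1) * (y.2 - x.2)))).
  by rewrite /sqdist; ring.
by rewrite eu ev; ring.
Qed.

Lemma ucoord_lin x y u : x <> y -> ucoord x y (lin x y u) = u.
Proof.
move=> /sqdist_gt0/lt0r_neq0 n0; apply: (mulIf n0).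
by rewrite /ucoord mulfVK // /sqdist /lin /=; ring.
Qed.

Lemma vcoord_lin x y u : vcoord x y (lin x y u) = 0.
Proof. by rewrite /vcoord /lin /=; ring. Qed.

(** In the frame, the quadrilateral with corners [(0, 0)], [(1, e)], [(1 + e, 0)], [(1, -e)]. For
    [e > 0] it has a corner at [x], where a previous path may arrive, and [y] in its interior. *)
Definition kite x y e : set P := [set z |
  `|vcoord x y z| <= e * ucoord x y z /\
  ucoord x y z + `|vcoord x y z| <= 1 + e].

Lemma seg_kite x y e : x <> y -> 0 < e -> seg x y `<=` kite x y e.
Proof.
move=> xy e0 z [u u01 ->]; rewrite /kite /= ucoord_lin // vcoord_lin normr0.
split; nra.
Qed.

(* With [a = |v| / e] and [b = 1 / e], the map [u - shift a b u] fixes both ends of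
   the slice [a <= u <= 1 + e (1 - a)] of the kite and has slope [a] on [[a, 1]]:
   it is injective unless [a = 0], when it collapses [[0, 1]] to [0]. *)
Definition shift a b u : R :=
  (1 - a) * Num.max 0 (Num.min (u - a) (1 - a - b * (u - 1))).

Lemma clampP (p q : R) : let m := Num.max 0 (Num.min p q) in
  [\/ m = 0 /\ (p <= 0 \/ q <= 0), m = p /\ 0 <= p <= q | m = q /\ 0 <= q <= p].
Proof.
move=> m; rewrite /m; case: (leP p q) => pq.
  case: (leP 0 p) => p0; first by constructor 2.
  by constructor 1; split => //; left; exact: ltW.
case: (leP 0 q) => q0; first by constructor 3; rewrite ltW.
by constructor 1; split => //; right; exact: ltW.
Qed.

(** The clamp in [shift] grows by at most [u' - u], and its factor [1 - a] is below 1 if [a > 0];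
    for [a >= 1] the clamp vanishes. For [a = 0] it has slope 1 on [[0, 1]] only, so strictness
    survives once a point lies outside. *)
Lemma shift_lt a b u u' : 0 <= a -> 0 < b -> u < u' ->
  u - shift a b u < u' - shift a b u' \/ [/\ a = 0, 0 <= u & u' <= 1].
Proof.
move=> a0 b0 uu'; rewrite /shift.
have bu : b * (u - 1) < b * (u' - 1) by rewrite ltr_pM2l //; lra.
(* Only the sign of [b * (t - 1)] and its monotonicity matter; naming these products makes the case
   analysis on the clamps linear. *)
have s0 t : b * (t - 1) <= 0 /\ t <= 1 \/ 0 < b * (t - 1) /\ 1 < t.
  by have [t1|t1] := leP t 1; [left|right]; split=> //; nra.
have := clampP (u - a) (1 - a - b * (u - 1)).
have := clampP (u' - a) (1 - a - b * (u' - 1)).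
move: (s0 u) (s0 u') => {s0}.
move: (b * _) (b * _) bu => w w' ww' su su'.
set m' := Num.max _ _; set m := Num.max _ _ => m'P mP.
have mm : m' - m <= u' - u.
  case: m'P => -[-> ?]; case: mP => -[-> ?]; lra.
have [a1|a1] := leP 1 a.
  have -> : m = 0 by case: mP => -[] //; lra.
  have -> : m' = 0 by case: m'P => -[] //; lra.
  by left; lra.
have [a00|an0] := eqVneq a 0; last first.
  have {}a0 : 0 < a by rewrite lt_neqAle eq_sym an0.
  by left; nra.
have [h|h] := pselect (0 <= u /\ u' <= 1); first by right; case: h.
left; suff : m' - m < u' - u by rewrite a00; lra.
have {h} : u < 0 \/ 1 < u'.
  by have [u0|] := leP 0 u; [right|left] => //; rewrite ltNge; apply/negP => u1; apply: h.
clear mm; move: mP m'P; rewrite a00 => mP m'P h.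
have m0 : 0 <= m by case: mP => -[-> ?]; lra.
case: m'P => -[-> Hm']; first lra.
  by case: h => h; [lra|case: su' => -[? ?]; lra].
case: mP => -[-> Hm].
- by case: h => h; case: su' => -[? ?]; case: Hm => ?; lra.
- by case: h => h; case: su' => -[? ?]; lra.
- by case: h => h; case: su' => -[? ?]; lra.
Qed.

Lemma shift_inj a b u u' : 0 <= a -> 0 < b ->
  u - shift a b u = u' - shift a b u' ->
  u = u' \/ [/\ a = 0, 0 <= u <= 1 & 0 <= u' <= 1].
Proof.
move=> a0 b0 e; have [uu'|uu'|] := ltgtP u u'; last by left.
  have [|[-> ? ?]] := shift_lt a0 b0 uu'; first by rewrite e ltxx.
  by right; split=> //; lra.
have [|[-> ? ?]] := shift_lt a0 b0 uu'; first by rewrite e ltxx.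
by right; split=> //; lra.
Qed.

(** In the frame [(u, v)] goes to [(u - shift, v)]: every line parallel to the segment is mapped to
    itself. *)
Definition push x y e z : P :=
  let c := shift (`|vcoord x y z| * e^-1) e^-1 (ucoord x y z) in
  (z.1 - c * (y.1 - x.1), z.2 - c * (y.2 - x.2)).

Lemma cont_push x y e : continuous (push x y e).
Proof. by rewrite /push /shift /ucoord /vcoord /=; solve_cont. Qed.

Lemma push_out x y e z : 0 < e -> ~ kite x y e z -> push x y e z = z.
Proof.
move=> e0 nk; have e'0 : 0 < e^-1 by rewrite invr_gt0.
suff s0 : shift (`|vcoord x y z| * e^-1) e^-1 (ucoord x y z) = 0.
  by apply: plane_eq; rewrite /push /= s0; ring.
rewrite /shift; move: nk; rewrite /kite /=.
move: `|_| (ucoord _ _ _) => v u nk.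
have [[-> _]|[_ h]|[_ h]] := clampP (u - v * e^-1) (1 - v * e^-1 - e^-1 * (u - 1)).
- by rewrite mulr0.
- case: nk; split.
    rewrite mulrC -ler_pdivrMr //; lra.
  have : v * e^-1 + e^-1 * (u - 1) <= 1 by lra.
  by rewrite (mulrC e^-1) -mulrDl ler_pdivrMr //; lra.
- case: nk; split.
    rewrite mulrC -ler_pdivrMr //; lra.
  have : v * e^-1 + e^-1 * (u - 1) <= 1 by lra.
  by rewrite (mulrC e^-1) -mulrDl ler_pdivrMr //; lra.
Qed.

Lemma push_seg x y e z : x <> y -> 0 < e -> seg x y z -> push x y e z = x.
Proof.
move=> xy e0 [u /andP[u0 u1] ->].
have e'0 : 0 < e^-1 by rewrite invr_gt0.
suff s0 : shift (`|vcoord x y (lin x y u)| * e^-1) e^-1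
                (ucoord x y (lin x y u)) = u.
  by apply: plane_eq; rewrite /push s0 /lin /=; ring.
rewrite vcoord_lin ucoord_lin // normr0 mul0r /shift !subr0 mul1r.
have w0 : e^-1 * (u - 1) <= 0 by rewrite pmulr_rle0 //; lra.
by case: (clampP u (1 - e^-1 * (u - 1))) => -[-> ?]; lra.
Qed.

(** The [v] coordinate is preserved, so [shift_inj] applies on a single line. Its exceptional case
    [a = 0] means [v = 0], that is, both points are on the segment. *)
Lemma push_inj x y e z w : x <> y -> 0 < e -> push x y e z = push x y e w ->
  z = w \/ seg x y z /\ seg x y w.
Proof.
move=> xy e0 E; have e'0 : 0 < e^-1 by rewrite invr_gt0.
have n0 := lt0r_neq0 (sqdist_gt0 xy).
have uE t : ucoord x y (push x y e t) =
    ucoord x y t - shift (`|vcoord x y t| * e^-1) e^-1 (ucoord x y t).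
  apply: (mulIf n0); rewrite mulrBl {1}/ucoord mulfVK // {2}/ucoord mulfVK //.
  by rewrite /push /sqdist /=; ring.
have vE t : vcoord x y (push x y e t) = vcoord x y t.
  by congr (_ * _); rewrite /push /=; ring.
have ev : vcoord x y z = vcoord x y w by rewrite -vE E vE.
have := congr1 (ucoord x y) E; rewrite !uE ev => /shift_inj[||eu|].
- by rewrite mulr_ge0 // ltW.
- by [].
- by left; apply: coord_inj xy _ _.
move=> [/eqP]; rewrite mulf_eq0 (gt_eqF e'0) orbF normr_eq0 => /eqP v0 z01 w01.
by right; split; [exists (ucoord x y z)|exists (ucoord x y w)] => //;
  apply: (coord_inj xy); rewrite ?ucoord_lin // vcoord_lin // ev.
Qed.

End Kite.

(** * Collapsing simple polygonal paths *)

Section Tame.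
Variable R : realType.
Local Notation P := (R * R)%type.
Implicit Types (x y z w q : P) (A B : set P) (u v e : R).

(* [tame a A x]: [A] is a simple polygonal path from [a] to [x]. *)
Inductive tame (a : P) : set P -> P -> Prop :=
| tame_point : tame a [set a] a
| tame_step A x y : tame a A x -> x <> y ->
    (exists2 e, 0 < e & forall z, A z -> kite x y e z -> z = x) ->
    tame a (A `|` seg x y) y.

Lemma tame_compact a A x : tame a A x -> compact A.
Proof.
elim=> [|{}A {}x y _ cA _ _]; first exact: compact_set1.
by apply: compactU => //; apply: seg_compact.
Qed.

Lemma seg_l x y : seg x y x.
Proof. by exists 0; rewrite ?lexx ?ler01 // lin0. Qed.

Lemma seg_r x y : seg x y y.
Proof. by exists 1; rewrite ?lexx ?ler01 // lin1. Qed.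

Lemma tame_start a A x : tame a A x -> A a.
Proof. by elim=> // *; left. Qed.

Lemma tame_end a A x : tame a A x -> A x.
Proof. by case=> // *; right; exact: seg_r. Qed.

(** First [push] collapses the newest segment to its start [x], fixing the earlier path because that
    meets the kite in [x] only; then the map for the earlier path is applied. *)
Lemma tame_collapse a A x : tame a A x -> exists F : P -> P,
  [/\ continuous F, forall z w, F z = F w -> z = w \/ A z /\ A w &
      forall z, A z -> F z = F a].
Proof.
elim=> [|{}A {}x y tA [F [cF iF FA]] xy [e e0 Ak]].
  exists id; split; [exact: cont_id|by left|by move=> z ->].
have push_fix z : A z -> push x y e z = z.
  move=> Az; have [/(Ak _ Az)->|] := pselect (kite x y e z).
    by apply: push_seg => //; exact: seg_l.
  exact: push_out.
exists (fun z => F (push x y e z)); split.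
- exact: cont_comp (@cont_push _ x y e) cF.
- have pushA z : A (push x y e z) -> (A `|` seg x y) z.
    move=> Ap; have [Epz|[_ ?]] := push_inj xy e0 (push_fix _ Ap).
        by left; rewrite -Epz.
    by right.
  move=> z w /iF[/(push_inj xy e0)[->|[? ?]]|[Az Aw]]; first by left.
    by right; split; right.
  by right; split; exact: pushA.
- move=> z zA; rewrite (push_fix a (tame_start tA)).
  case: zA => [Az|szy]; first by rewrite push_fix // FA.
  by rewrite push_seg // FA //; exact: tame_end tA.
Qed.

Lemma seg_sub x y z : seg x y z -> seg x z `<=` seg x y.
Proof.
move=> [u /andP[u0 u1] ->] w [v /andP[v0 v1] ->]; exists (v * u).
  by rewrite mulr_ge0 //= mulr_ile1.
by apply: plane_eq; rewrite /lin /=; ring.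
Qed.

(** The smaller kite is the image of the larger under the homothety with centre [x] and ratio
    [t <= 1], so the same [e] serves. *)
Lemma kite_sub x y z e : 0 < e -> x <> z -> seg x y z ->
  kite x z e `<=` kite x y e.
Proof.
move=> e0 xz [t /andP[t0 t1] zE] w.
have {}t0 : 0 < t.
  by rewrite lt_neqAle t0 andbT; apply/eqP => t0'; apply: xz; rewrite zE -t0' lin0.
have tn0 := lt0r_neq0 t0.
have nE : sqdist x z = t * t * sqdist x y by rewrite zE sqdist_lin expr2.
have uE : ucoord x y w = t * ucoord x z w.
  rewrite /ucoord nE !invfM zE /lin /=.
  by move: (sqdist x y)^-1 => i; field.
have vE : vcoord x y w = t * vcoord x z w.
  rewrite /vcoord nE !invfM zE /lin /=.
  by move: (sqdist x y)^-1 => i; field.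
rewrite /kite /= uE vE (normrM t) (ger0_norm (ltW t0)).
move: `|vcoord x z w| (ucoord x z w) => v u [h1 h2]; split.
  by rewrite mulrCA ler_pM2l.
rewrite -mulrDr; have := ler_wpM2l (ltW t0) h2; nra.
Qed.

Lemma tame_truncate a A x z : tame a A x -> A z ->
  exists2 B, tame a B z & B `<=` A.
Proof.
elim=> [->|{}A {}x y tA IH xy [e e0 Ak] zA].
  by exists [set a] => //; exact: tame_point.
have [Az|nAz] := pselect (A z).
  by have [B tB BA] := IH Az; exists B => // w /BA; left.
have {zA nAz} [nxz sz] : x <> z /\ seg x y z.
  by case: zA => [/nAz//|sz]; split=> // xz; apply: nAz; rewrite -xz; exact: tame_end tA.
exists (A `|` seg x z).
  by apply: tame_step => //; exists e => // w Aw /(kite_sub e0 nxz sz); exact: Ak.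
by move=> w [?|/(seg_sub sz)]; [left|right].
Qed.

Lemma kite_mono x y e e' : 0 < e' -> e' <= e -> kite x y e' `<=` kite x y e.
Proof.
move=> e'0 ee z; rewrite /kite /=; have := normr_ge0 (vcoord x y z).
move: `|_| (ucoord _ _ _) => v u v0 [h1 h2].
have u0 : 0 <= u by rewrite -(pmulr_rge0 _ e'0); exact: le_trans h1.
by split; nra.
Qed.

End Tame.

(** * Extending polygonal paths *)

Section Extend.
Variable R : realType.
Local Notation P := (R * R)%type.
Implicit Types (x y z w q : P) (A B : set P) (u v e d : R).

Lemma sqdist_coord x y w u : x <> y -> sqdist w (lin x y u) =
  sqdist x y * ((ucoord x y w - u) ^+ 2 + vcoord x y w ^+ 2).
Proof.
move=> xy; have n0 := lt0r_neq0 (sqdist_gt0 xy).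
pose U := (w.1 - x.1) * (y.1 - x.1) + (w.2 - x.2) * (y.2 - x.2).
pose V := (w.2 - x.2) * (y.1 - x.1) - (w.1 - x.1) * (y.2 - x.2).
have -> : ucoord x y w = U / sqdist x y by [].
have -> : vcoord x y w = V / sqdist x y by [].
apply: (mulIf n0).
transitivity ((U - u * sqdist x y) ^+ 2 + V ^+ 2); last by field.
by rewrite /U /V /sqdist /lin /=; ring.
Qed.

Lemma kite_near x y d : x <> y -> 0 < d -> exists2 e, 0 < e &
  forall w, kite x y e w -> exists2 q, seg x y q & sqdist w q < d.
Proof.
move=> xy d0; have n0 := sqdist_gt0 xy.
(* At the nearest point of the segment the squared offsets in the frame are at most [e] along it and
   [4 * e] across it, hence 5; adding 1 makes the bound strict. *)
pose m := 5 * sqdist x y + 1.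
have m0 : 0 < m by rewrite /m; lra.
pose e := Num.min 1 (d / m).
have e0 : 0 < e by rewrite lt_min ltr01 divr_gt0.
have e1 : e <= 1 by rewrite ge_min lexx.
have em : e * m <= d by rewrite -ler_pdivlMr // ge_min lexx orbT.
exists e => // w [h1 h2].
have v0 := normr_ge0 (vcoord x y w).
have u0 : 0 <= ucoord x y w by rewrite -(pmulr_rge0 _ e0); exact: le_trans h1.
pose s := Num.min (ucoord x y w) 1.
exists (lin x y s).
  by exists s => //; rewrite /s le_min u0 ler01 /= ge_min lexx orbT.
rewrite sqdist_coord // -(real_normK (num_real (vcoord x y w))).
have su : 0 <= ucoord x y w - s <= e.
  by rewrite /s; case: (leP (ucoord x y w) 1) => ?; lra.
move: `|_| (ucoord _ _ _) su h1 h2 v0 u0 => v u su h1 h2 v0 u0.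
have v2 : v <= 2 * e by nra.
have vv : v ^+ 2 <= 4 * e by rewrite expr2; nra.
have uu : (u - s) ^+ 2 <= e by rewrite expr2; nra.
apply: lt_le_trans em; rewrite /m.
apply: (@le_lt_trans _ _ (sqdist x y * (e + 4 * e))); last by nra.
by rewrite ler_pM2l // lerD.
Qed.

(** The earlier segments have a positive distance from the new one, so a kite close to it misses
    them. The last segment touches it at [z], and there the kite has to be thinner than the angle
    between the two. *)
Lemma tame_kite a A z y : tame a A z -> z <> y ->
  (forall w, A w -> seg z y w -> w = z) ->
  exists2 e, 0 < e & forall w, A w -> kite z y e w -> w = z.
Proof.
case=> [zy _|{}A x {}z tA xz [e0 e00 Ak] zy Az].
  by exists 1 => // w ->.
have nAz : ~ A z.
  by move=> /Ak H; apply: (xz); rewrite H //; apply: (seg_kite xz e00); exact: seg_r.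
have [|d d0 dA] := compact_gap (tame_compact tA) (@seg_compact _ z y).
  rewrite -subset0 => w [Aw sw]; apply: nAz.
  by rewrite -(Az w) //; left.
have [e1 e10 ke1] := kite_near zy d0.
suff [e2 e20 ke2] : exists2 e, 0 < e &
    forall w, seg x z w -> kite z y e w -> w = z.
  have emin : 0 < Num.min e1 e2 by rewrite lt_min e10.
  exists (Num.min e1 e2) => // w [Aw|sw] kw.
    have /ke1[q sq] : kite z y e1 w by apply: kite_mono kw => //; rewrite ge_min lexx.
    by rewrite ltNge dA.
  by apply: ke2 => //; apply: kite_mono kw => //; rewrite ge_min lexx orbT.
have uE t : ucoord z y (lin x z t) = (1 - t) * ucoord z y x.
  by rewrite /ucoord /lin /=; ring.
have vE t : vcoord z y (lin x z t) = (1 - t) * vcoord z y x.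
  by rewrite /vcoord /lin /=; ring.
have [v0|v0] := eqVneq (vcoord z y x) 0.
  exists 1 => // w [t /andP[t0 t1] ->] [+ _]; rewrite uE vE v0 mulr0 normr0 mul1r.
  have [->|tn1] := eqVneq t 1; first by rewrite lin1.
  have {}t1 : 0 < 1 - t by rewrite subr_gt0 lt_neqAle tn1.
  rewrite pmulr_rge0 // le_eqVlt => /orP[/eqP u0|u0].
    case: xz; apply: (coord_inj zy); rewrite ?v0 -?u0 /ucoord /vcoord !subrr.
      by rewrite !(mul0r, addr0).
    by rewrite !(mul0r, subr0).
  (* Now [x] is on the ray from [z] through [y]. With this [s] the point at parameter [1 - s] lies
     on both segments, so it is [z], against [s > 0]. *)
  pose s := Num.min 1 (ucoord z y x)^-1.
  have s0 : 0 < s by rewrite lt_min ltr01 invr_gt0.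
  have s1 : s <= 1 by rewrite ge_min lexx.
  case: xz; apply/(coord_inj zy).
    have : ucoord z y (lin x z (1 - s)) = 0.
      rewrite (Az (lin x z (1 - s))).
      - by rewrite /ucoord !subrr !mul0r addr0 mul0r.
      - by right; exists (1 - s) => //; lra.
      exists (s * ucoord z y x).
        rewrite pmulr_lge0 // ltW //=.
        by rewrite -ler_pdivlMr // div1r ge_min lexx orbT.
      apply: (coord_inj zy); rewrite ?uE ?vE ?ucoord_lin ?vcoord_lin // ?v0 ?mulr0 //.
      by ring.
    rewrite uE => /eqP; rewrite mulf_eq0 (gt_eqF u0) orbF => /eqP; lra.
  by rewrite v0 /vcoord !subrr !mul0r subrr mul0r.
(* The slope [k] is chosen so that [k * ucoord z y x] stays strictly below [|vcoord z y x|]. *)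
pose M := `|ucoord z y x| + 1.
have M0 : 0 < M by rewrite ltr_wpDl.
have v0' : 0 < `|vcoord z y x| by rewrite normr_gt0.
pose k := `|vcoord z y x| / M; have k0 : 0 < k by rewrite divr_gt0.
have kM : `|vcoord z y x| = k * M by rewrite /k divfK // gt_eqF.
exists k => // w [t /andP[t0 t1] ->] [+ _].
rewrite uE vE normrM (ger0_norm (_ : 0 <= 1 - t)) ?subr_ge0 // kM.
have [->|tn1] := eqVneq t 1; first by rewrite lin1.
have {}t1 : 0 < 1 - t by rewrite subr_gt0 lt_neqAle tn1.
rewrite mulrCA !ler_pM2l // => Mu; exfalso.
by have := ler_norm (ucoord z y x); move: Mu; rewrite /M; lra.
Qed.

(** The segment may meet the path again: the path is cut at the last such point, and only the rest
    of the segment is appended. *)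
Lemma tame_extend a A x y : tame a A x ->
  exists2 B, tame a B y & B `<=` A `|` seg x y.
Proof.
move=> tA.
have cA : closed A by apply: compact_closed (tame_compact tA); exact: norm_hausdorff.
have cC : closed (lin x y @^-1` A).
  by apply: closed_comp => // t _; exact: cont_lin.
have [||s [/= As /andP[s0 s1]] sm] := @closed_last _ _ 0 1 cC.
- by rewrite /= lin0; exact: tame_end tA.
- exact: ler01.
have [B tB BA] := tame_truncate tA As.
have [zy|zy] := pselect (lin x y s = y).
  by rewrite zy in tB; exists B => // w /BA; left.
have sub : seg (lin x y s) y `<=` seg x y.
  move=> w [t /andP[t0 t1] ->]; exists (s + t * (1 - s)); first by nra.
  by apply: plane_eq; rewrite /lin /=; ring.
have [|e e0 eB] := tame_kite tB zy.
  move=> w /BA Aw [t /andP[t0 t1] wE].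
  have wE' : w = lin x y (s + t * (1 - s)).
    by rewrite wE; apply: plane_eq; rewrite /lin /=; ring.
  have : s + t * (1 - s) <= s.
    by apply: sm; [rewrite /= -wE'|nra].
  rewrite gerDl => ts0.
  have /eqP : t * (1 - s) = 0.
    by apply/eqP; rewrite eq_le ts0 mulr_ge0 // subr_ge0.
  rewrite mulf_eq0 => /orP[/eqP t00|/eqP s11]; first by rewrite wE t00 lin0.
  by case: zy; rewrite (_ : s = 1) ?lin1 //; lra.
exists (B `|` seg (lin x y s) y).
  by apply: tame_step => //; exists e.
by move=> w [/BA|/sub]; [left|right].
Qed.

End Extend.

(** * Polygonal paths along a curve *)

Section Along.
Variable R : realType.
Local Notation P := (R * R)%type.
Implicit Types (x y z w q : P) (A B W : set P).

Lemma locally_constant_le (Q : R -> Prop) (a b : R) : a <= b ->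
  (forall t, a <= t <= b -> exists2 e, 0 < e &
     forall t', `|t' - t| < e -> (Q t <-> Q t')) ->
  Q a -> Q b.
Proof.
move=> ab loc Qa; apply: contrapT => nQb.
pose C := [set t | a <= t <= b /\ Q t].
have C0 : C a by rewrite /C /= lexx ab.
have hC : has_sup C.
  by split; [exists a|exists b => t [/andP[]]].
have [sa sb] : a <= sup C /\ sup C <= b.
  split; first by apply: ub_le_sup => //; exact: hC.2.
  by apply: ge_sup; [exact: hC.1|move=> t [/andP[]]].
have [|e e0 se] := loc (sup C); first by rewrite sa sb.
have [t [/andP[ta tb] Qt] st] := sup_adherent e0 hC.
have ts : t <= sup C by apply: ub_le_sup => //; [exact: hC.2|split => //; rewrite ta].
have Qs : Q (sup C).
  by apply/(se t) => //; rewrite ltr_norml; apply/andP; split; lra.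
have {}sb : sup C < b.
  by rewrite lt_neqAle sb andbT; apply/eqP => sb'; apply: nQb; rewrite -sb'.
pose t' := Num.min (sup C + e / 2) b.
have st' : sup C < t' by rewrite lt_min sb andbT; lra.
have t'e : t' <= sup C + e / 2 by rewrite ge_min lexx.
have t'b : t' <= b by rewrite ge_min lexx orbT.
have : t' <= sup C.
  apply: ub_le_sup; [exact: hC.2|split; first by apply/andP; split; lra].
  by apply/(se t') => //; rewrite ltr_norml; apply/andP; split; lra.
by rewrite leNgt st'.
Qed.

Lemma locally_constant (Q : R -> Prop) (I : R -> Prop) :
  (forall s t u, I s -> I u -> s <= t <= u -> I t) ->
  (forall t, I t -> exists2 e, 0 < e &
     forall t', `|t' - t| < e -> (Q t <-> Q t')) ->
  forall s t, I s -> I t -> Q s -> Q t.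
Proof.
move=> cI loc s t Is It Qs; have [st|ts] := leP s t.
  by apply: locally_constant_le st _ Qs => u /(cI _ _ _ Is It); exact: loc.
apply: contrapT => nQt.
suff : ~ Q s by [].
apply: (@locally_constant_le (fun u => ~ Q u) _ _ (ltW ts) _ nQt).
move=> u /(cI _ _ _ It Is)/loc[e e0 ue]; exists e => // t' /ue[h1 h2].
by split=> nQ q; apply: nQ; [exact: h2|exact: h1].
Qed.

Lemma cont_near (f : R -> R) (t d : R) : continuous f -> f t < d ->
  exists2 e, 0 < e & forall t', `|t' - t| < e -> f t' < d.
Proof.
move=> cf ftd; have [e /= e0 te] : nbhs t [set t' | f t' < d].
  apply: (cf t [set y | y < d]); exists (d - f t); first by rewrite /= subr_gt0.
  by move=> y; rewrite /ball_ /= ltr_norml => /andP[]; lra.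
by exists e => // t' tt'; apply: te; rewrite /ball_ /= distrC.
Qed.

Lemma sqdistxx x : sqdist x x = 0.
Proof. by rewrite /sqdist !subrr !mul0r addr0. Qed.

Lemma seg_ball x y d : sqdist x y < d ->
  forall z, seg x y z -> sqdist x z < d.
Proof.
move=> xyd z [u /andP[u0 u1] ->]; rewrite sqdist_lin; apply: le_lt_trans xyd.
by rewrite ler_piMl ?sqdist_ge0 // expr_le1.
Qed.

Lemma segC x y : seg x y = seg y x.
Proof.
by apply/seteqP; split=> z [u /andP[u0 u1] ->]; exists (1 - u);
  [lra|by apply: plane_eq; rewrite /lin /=; ring|lra
  |by apply: plane_eq; rewrite /lin /=; ring].
Qed.

(** Being reachable by a polygonal path in [W] is a locally constant property of the parameter:
    nearby points of the curve are joined by a segment in a disc contained in [W]. *)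
Lemma tame_along a W (c : R -> P) t0 t1 : continuous c ->
  (forall t, 0 < t < 1 -> exists2 d, 0 < d &
     forall z, sqdist (c t) z < d -> W z) ->
  0 < t0 < 1 -> 0 < t1 < 1 -> seg a (c t0) `<=` a |` W ->
  exists2 A, tame a A (c t1) & A `<=` a |` W.
Proof.
move=> cc cW t001 t101 st0.
pose Q t := exists2 A, tame a A (c t) & A `<=` a |` W.
suff : Q t1 by [].
apply: (@locally_constant Q (fun t => 0 < t < 1)) t001 t101 _.
- by move=> s t u; lra.
- move=> t /cW[d d0 dW].
  have [||e e0 te] := @cont_near (fun t' => sqdist (c t) (c t')) t d.
  + by apply: cont_sqdist => // s; exact: cvg_cst.
  + by rewrite sqdistxx.
  exists e => // t' /te /seg_ball sW.
  have step s s' : seg (c s) (c s') `<=` seg (c t) (c t') -> Q s -> Q s'.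
    move=> ss [A tA AW]; have [B tB BA] := tame_extend (c s') tA.
    by exists B => // z /BA[/AW//|/ss/sW/dW]; right.
  by split; apply: step => //; rewrite segC.
- have [B tB BA] := tame_extend (c t0) (tame_point a).
  by exists B => // z /BA[->|/st0//]; left.
Qed.

Lemma curve_gap (c : R -> P) z : continuous c ->
  (forall t, 0 <= t <= 1 -> c t <> z) ->
  exists2 d, 0 < d & forall t, 0 <= t <= 1 -> d <= sqdist z (c t).
Proof.
move=> cc cz.
have [||t + tm] := @EVT_min R (fun t => sqdist z (c t)) 0 1.
- exact: ler01.
- by apply: continuous_subspaceT; apply: cont_sqdist => // ?; exact: cvg_cst.
rewrite in_itv /= => t01; exists (sqdist z (c t)).
  by apply: sqdist_gt0 => zc; apply: (cz t).
by move=> s s01; apply: tm; rewrite in_itv.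
Qed.

(** [s] is the last parameter with squared distance at most [d]; the intermediate value theorem on
    [[s, 1]] forces equality. *)
Lemma last_exit (c : R -> P) d : continuous c -> 0 < d < sqdist (c 0) (c 1) ->
  exists s, [/\ 0 < s < 1, sqdist (c 0) (c s) = d &
    forall t, s < t <= 1 -> d < sqdist (c 0) (c t)].
Proof.
move=> cc /andP[d0 d1]; pose f t := sqdist (c 0) (c t).
have cf : continuous f by apply: cont_sqdist => // ?; exact: cvg_cst.
have cC : closed [set t | f t <= d].
  by apply: (closed_comp (D := [set y | y <= d])) => [t _|]; [exact: cf|exact: closed_le].
have [||s [/= fs /andP[s0 s1]] sm] := @closed_last _ _ 0 1 cC.
- by rewrite /= /f sqdistxx ltW.
- exact: ler01.
have exitd t : s < t <= 1 -> d < f t.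
  by move=> /andP[st t1]; rewrite ltNge; apply/negP => /sm /(_ t1); rewrite leNgt st.
have [||u] := @IVT R f s 1 d s1.
- exact: continuous_subspaceT.
- by rewrite ge_min fs /= le_max [X in _ || X]ltW ?orbT.
rewrite in_itv /= => /andP[su u1] fu.
have us : u = s by apply/eqP; rewrite eq_le su andbT; apply: sm; rewrite /= ?fu.
rewrite us in fu; exists s; split=> //.
rewrite !lt_neqAle s0 s1 !andbT; apply/andP; split; apply/eqP => s01.
  by move: d0; rewrite -fu -s01 /f sqdistxx ltxx.
by move: d1; rewrite -fu s01 /f ltxx.
Qed.

End Along.

(** * Drawings of finite graphs *)

Lemma fin_gap (R : realType) (T : finType) (Q : T -> R -> Prop) :
  (forall i d d', 0 < d' -> d' <= d -> Q i d -> Q i d') ->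
  (forall i, exists2 d, 0 < d & Q i d) ->
  exists2 d, 0 < d & forall i, Q i d.
Proof.
move=> Qmono /(_ _)/cid2 Qd; pose d i := s2val (Qd i).
have d0 i : 0 < d i by exact: s2valP (Qd i).
have Qdi i : Q i (d i) by exact: s2valP' (Qd i).
suff [m m0 md] : exists2 m, 0 < m & forall i, i \in enum T -> m <= d i.
  by exists m => // i; apply: Qmono (Qdi i); rewrite ?md ?mem_enum.
elim: (enum T) => [|i s [m m0 md]]; first by exists 1.
exists (Num.min (d i) m); first by rewrite lt_min d0.
move=> j; rewrite inE => /orP[/eqP->|/md mdj]; first by rewrite ge_min lexx.
by rewrite ge_min mdj orbT.
Qed.

(** A form of [planar] suited to induction: curves are continuous on the whole line, both directions
    of an edge trace one curve, and a vertex is removed by shrinking [S] inside a fixed type. *)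
Record drawing (R : realType) (V : finType) (S : {set V}) (r : rel V)
    (p : V -> R * R) (g : V -> V -> R -> R * R) : Prop := Drawing {
  dr_inj : {in S &, injective p};
  dr_sym : symmetric r;
  dr_mem : forall x y, r x y -> [/\ x \in S, y \in S & x != y];
  dr_cont : forall x y, r x y -> continuous (g x y);
  dr_arc : forall x y s t, r x y -> 0 <= s <= 1 -> 0 <= t <= 1 ->
    g x y s = g x y t -> s = t;
  dr_start : forall x y, r x y -> g x y 0 = p x;
  dr_rev : forall x y t, r x y -> g y x t = g x y (1 - t);
  dr_vertex : forall x y t z, r x y -> 0 < t < 1 -> z \in S -> g x y t <> p z;
  dr_cross : forall x y x' y' s t, r x y -> r x' y' -> 0 < s < 1 -> 0 < t < 1 ->
    g x y s = g x' y' t -> x = x' /\ y = y' \/ x = y' /\ y = x' }.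

(** * Making a drawing radial near a vertex *)

Section Straighten.
Variables (R : realType) (V : finType) (S : {set V}) (r : rel V).
Local Notation P := (R * R)%type.
Variables (p : V -> P) (g : V -> V -> R -> P).
Hypothesis D : drawing S r p g.

Lemma dr_end x y : r x y -> g x y 1 = p y.
Proof.
move=> rxy; have ryx : r y x by rewrite (dr_sym D).
by rewrite -(dr_start D ryx) (dr_rev D _ rxy) subr0.
Qed.

Lemma dr_ends x y t z : r x y -> 0 <= t <= 1 -> z \in S -> g x y t = p z ->
  z = x /\ t = 0 \/ z = y /\ t = 1.
Proof.
move=> rxy /andP[t0 t1] zS E; have [xS yS _] := dr_mem D rxy.
have [t00|tn0] := eqVneq t 0.
  left; split=> //; apply: (dr_inj D) => //.
  by rewrite -E t00 (dr_start D).
have [t11|tn1] := eqVneq t 1.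
  right; split=> //; apply: (dr_inj D) => //.
  by rewrite -E t11 dr_end.
case: (dr_vertex D rxy _ zS E).
by rewrite !lt_neqAle eq_sym tn0 t0 tn1.
Qed.

Variable v : V.
Hypothesis vS : v \in S.

Lemma disc_gap : exists2 d, 0 < d &
  (forall z, z \in S -> z != v -> d < sqdist (p v) (p z)) /\
  (forall x y t, r x y -> x != v -> y != v -> 0 <= t <= 1 ->
    d < sqdist (p v) (g x y t)).
Proof.
have [||d1 d10 dv] := @fin_gap R V
  (fun z d => z \in S -> z != v -> d < sqdist (p v) (p z)).
- by move=> z d d' _ d'd dz zS zv; apply: le_lt_trans d'd (dz zS zv).
- move=> z; have [zv|zv] := eqVneq z v; first by exists 1.
  have [zS|//] := boolP (z \in S); last by exists 1.
  have d0 : 0 < sqdist (p v) (p z).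
    by apply: sqdist_gt0 => /(dr_inj D vS zS) vz; rewrite vz eqxx in zv.
  by exists (sqdist (p v) (p z) / 2) => [|_ _]; lra.
have [||d2 d20 de] := @fin_gap R (V * V)%type
  (fun e d => r e.1 e.2 -> e.1 != v -> e.2 != v -> forall t, 0 <= t <= 1 ->
    d < sqdist (p v) (g e.1 e.2 t)).
- by move=> e d d' _ d'd de re e1 e2 t t01; apply: le_lt_trans d'd (de re e1 e2 t t01).
- move=> [x y] /=; have [rxy|] := boolP (r x y); last by exists 1.
  have [->|xv] := eqVneq x v; first by exists 1.
  have [->|yv] := eqVneq y v; first by exists 1.
  have [|d d0 dg] := @curve_gap R (g x y) (p v) (dr_cont D rxy).
    move=> t t01 /(dr_ends rxy t01 vS)[] [E _].
      by rewrite E eqxx in xv.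
    by rewrite E eqxx in yv.
  exists (d / 2) => [|_ _ _ t /dg]; lra.
exists (Num.min d1 d2); first by rewrite lt_min d10.
split=> [z zS zv|x y t rxy xv yv t01]; rewrite gt_min.
  by rewrite dv.
by rewrite (de (x, y)) // orbT.
Qed.

(** In a disc around [v] free of other vertices and of edges not at [v], each edge at [v] is
    replaced up to its last exit by a radius. The last clause lets a second vertex be treated
    without losing the radii at the first. *)
Lemma straighten : exists g', [/\ drawing S r p g',
  (forall w, r v w -> exists2 s, 0 < s < 1 &
     forall t, 0 <= t <= s -> g' v w t = lin (p v) (g' v w s) (t / s)) &
  (forall x y, r x y -> x != v -> exists2 s, 0 < s < 1 &
     forall t, 0 <= t <= s -> g' x y t = g x y t)].
Proof.
have [d d0 [dv de]] := disc_gap.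
have /choice[s sP] : forall w, exists s, r v w ->
    [/\ 0 < s < 1, sqdist (p v) (g v w s) = d &
        forall t, s < t <= 1 -> d < sqdist (p v) (g v w t)].
  move=> w; have [rvw|nr] := boolP (r v w); last by exists 0.
  have [|s] := @last_exit R (g v w) d (dr_cont D rvw).
    rewrite d0 (dr_start D rvw) dr_end //; have [_ wS vw] := dr_mem D rvw.
    by apply: dv => //; rewrite eq_sym.
  by rewrite (dr_start D rvw) => sP; exists s.
pose X w := g v w (s w).
(* One formula, visibly continuous, for the radius up to [s w] and the old curve afterwards. *)
pose h w t := lin (p v) (g v w (Num.max t (s w))) (Num.min 1 (t / s w)).
have h_in w t : r v w -> 0 <= t <= s w -> h w t = lin (p v) (X w) (t / s w).
  move=> /sP[/andP[s0 s1] _ _] /andP[t0 ts]; rewrite /h (max_idPr ts).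
  by rewrite (min_idPr _) // ler_pdivrMr // mul1r.
have h_out w t : r v w -> s w <= t -> h w t = g v w t.
  move=> /sP[/andP[s0 s1] _ _] st; rewrite /h (max_idPl st).
  by rewrite (min_idPl _) ?lin1 // ler_pdivlMr // mul1r.
have h_cont w : r v w -> continuous (h w).
  move=> rvw; have cg : continuous (fun t => g v w (Num.max t (s w))).
    by apply: cont_comp (dr_cont D rvw); solve_cont.
  by rewrite /h /lin; solve_cont.
have h_dist_in w t : r v w -> 0 <= t <= s w ->
    sqdist (p v) (h w t) = (t / s w) ^+ 2 * d.
  by move=> rvw ts; rewrite h_in // sqdist_lin /X; have [_ -> _] := sP w rvw.
have in_unit w t : r v w -> 0 <= t <= s w -> 0 <= t / s w <= 1.
  move=> /sP[/andP[s0 s1] _ _] /andP[t0 ts].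
  by rewrite divr_ge0 ?(ltW s0) // ler_pdivrMr // mul1r.
have h_le w t : r v w -> 0 <= t <= s w -> sqdist (p v) (h w t) <= d.
  move=> rvw ts; rewrite h_dist_in // ler_piMl ?(ltW d0) //.
  by have /andP[? ?] := in_unit w t rvw ts; rewrite expr_le1.
have h_gt w t : r v w -> s w < t <= 1 -> d < sqdist (p v) (h w t).
  move=> rvw st; rewrite h_out //; first by have [_ _] := sP w rvw; apply.
  by case/andP: st => /ltW.
have h_arc w t t' : r v w -> 0 <= t <= 1 -> 0 <= t' <= 1 -> h w t = h w t' -> t = t'.
  move=> rvw t01 t'01 E; have [/andP[s0 s1] _ _] := sP w rvw.
  have [ts|ts] := leP t (s w); have [t's|t's] := leP t' (s w).
  - have tsP : 0 <= t <= s w by lra.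
    have t'sP : 0 <= t' <= s w by lra.
    have := congr1 (sqdist (p v)) E; rewrite !h_dist_in // => /(mulIf (lt0r_neq0 d0)).
    move=> /eqP; rewrite eqrXn2 //; last 2 first.
    + by case/andP: (in_unit _ _ rvw tsP).
    + by case/andP: (in_unit _ _ rvw t'sP).
    by move=> /eqP/mulIf; apply; rewrite invr_neq0 // gt_eqF.
  - have : sqdist (p v) (h w t) <= d by apply: h_le => //; lra.
    by rewrite E leNgt h_gt //; lra.
  - have : sqdist (p v) (h w t') <= d by apply: h_le => //; lra.
    by rewrite -E leNgt h_gt //; lra.
  - by move: E; rewrite !h_out ?(ltW ts) ?(ltW t's) //; exact: (dr_arc D).
pose g' x y := if x == v then h y else
  if y == v then fun t => h x (1 - t) else g x y.
have rvC x : r x v = r v x by exact: (dr_sym D).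
(* Every interior point is either an old point outside the disc, or on a radius. *)
have pos x y t : r x y -> 0 < t < 1 ->
  (exists2 t', 0 < t' < 1 & g' x y t = g x y t') /\ d < sqdist (p v) (g' x y t) \/
  exists w u, [/\ x = v /\ y = w \/ x = w /\ y = v, r v w, 0 < u <= 1 &
    g' x y t = lin (p v) (X w) u].
  have half w t1 : r v w -> 0 < t1 < 1 ->
    (exists2 t', 0 < t' < 1 & h w t1 = g v w t') /\ d < sqdist (p v) (h w t1) \/
    exists2 u, 0 < u <= 1 & h w t1 = lin (p v) (X w) u.
    move=> rvw /andP[t0 t1']; have [ts|ts] := leP t1 (s w); last first.
      left; split; last by rewrite h_gt // ts ltW.
      by exists t1; rewrite ?t0 // h_out // ltW.
    right; have tsP : 0 <= t1 <= s w by rewrite ltW.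
    exists (t1 / s w); last exact: h_in.
    have [/andP[s0 s1] _ _] := sP w rvw.
    by rewrite divr_gt0 //=; case/andP: (in_unit _ _ rvw tsP).
  move=> rxy t01; rewrite /g'; have [xv|xv] := eqVneq x v.
    have rvy : r v y by rewrite -xv.
    have [[? ?]|[u u0 hE]] := half y t rvy t01; first by left; rewrite xv.
    by right; exists y, u; split=> //; left.
  have [yv|yv] := eqVneq y v.
    have rvx : r v x by rewrite -rvC -yv.
    have t01' : 0 < 1 - t < 1 by lra.
    have [[[t' t'01 hE] ?]|[u u0 hE]] := half x _ rvx t01'.
      left; split=> //; exists (1 - t'); first by lra.
      by rewrite hE yv (dr_rev D _ rvx) subKr.
    by right; exists x, u; split=> //; right.
  left; split; first by exists t.
  by apply: de => //; lra.
exists g'; split; first split.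
- exact: (dr_inj D).
- exact: (dr_sym D).
- exact: (dr_mem D).
- move=> x y rxy; rewrite /g'; have [xv|xv] := eqVneq x v.
    by apply: h_cont; rewrite -xv.
  have [yv|yv] := eqVneq y v; last exact: (dr_cont D).
  have rvx : r v x by rewrite -rvC -yv.
  have c1 : continuous (fun t : R => 1 - t) by solve_cont.
  exact: cont_comp c1 (h_cont x rvx).
- move=> x y t t' rxy t01 t'01; rewrite /g'; have [xv|xv] := eqVneq x v.
    by apply: h_arc => //; rewrite -xv.
  have [yv|yv] := eqVneq y v; last exact: (dr_arc D).
  have rvx : r v x by rewrite -rvC -yv.
  move=> E; suff : 1 - t = 1 - t' by lra.
  by apply: (h_arc x) => //; lra.
- move=> x y rxy; rewrite /g'; have [xv|xv] := eqVneq x v.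
    have rvy : r v y by rewrite -xv.
    have [/andP[s0 s1] _ _] := sP y rvy.
    by rewrite h_in ?lexx ?ltW // mul0r lin0 xv.
  have [yv|yv] := eqVneq y v; last exact: (dr_start D).
  have rvx : r v x by rewrite -rvC -yv.
  have [/andP[s0 s1] _ _] := sP x rvx.
  by rewrite subr0 h_out ?dr_end // ltW.
- move=> x y t rxy; have [_ _ xy] := dr_mem D rxy.
  rewrite /g'; have [yv|yv] := eqVneq y v; have [xv|xv] := eqVneq x v.
  + by rewrite xv yv eqxx in xy.
  + by rewrite subKr.
  + by [].
  + exact: (dr_rev D).
- move=> x y t z rxy t01 zS; have [[[t' t'01 E] _]|[w [u [_ rvw u01 E]]]] := pos x y t rxy t01.
    by rewrite E; exact: (dr_vertex D).
  rewrite E => zE; have [_ dX _] := sP w rvw.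
  have : sqdist (p v) (p z) = u ^+ 2 * d by rewrite -zE sqdist_lin dX.
  have [->|zv] := eqVneq z v.
    by rewrite sqdistxx => /esym/eqP; rewrite mulf_eq0 expf_eq0 /= !gt_eqF //; case/andP: u01.
  move=> dE; have := dv z zS zv; rewrite dE ltNge ler_piMl ?(ltW d0) //.
  by case/andP: u01 => /ltW u0 u1; rewrite expr_le1.
- move=> x y x' y' t t' rxy rxy' t01 t'01 E.
  have radius_le w u : r v w -> 0 < u <= 1 -> sqdist (p v) (lin (p v) (X w) u) <= d.
    move=> /sP[_ dX _] /andP[/ltW u0 u1].
    by rewrite sqdist_lin dX ler_piMl ?(ltW d0) // expr_le1.
  have [[[t1 t101 E1] d1]|[w [u [xyw rvw u01 E1]]]] := pos x y t rxy t01;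
  have [[[t2 t201 E2] d2]|[w' [u' [xyw' rvw' u01' E2]]]] := pos x' y' t' rxy' t'01.
  + by apply: (dr_cross D) rxy rxy' t101 t201 _; rewrite -E1 E E2.
  + by have := radius_le _ _ rvw' u01'; rewrite -E2 -E leNgt d1.
  + by have := radius_le _ _ rvw u01; rewrite -E1 E leNgt d2.
  have [s01 dX _] := sP w rvw; have [s01' dX' _] := sP w' rvw'.
  (* Two meeting radii have equal parameters, by distance from the centre, hence equal exit points.
     These are interior to the old edges, so the edges coincide. *)
  have EE : lin (p v) (X w) u = lin (p v) (X w') u' by rewrite -E1 E E2.
  have uu : u = u'.
    have := congr1 (sqdist (p v)) EE; rewrite !sqdist_lin dX dX'.
    move=> /(mulIf (lt0r_neq0 d0))/eqP; rewrite eqrXn2 //; first by move/eqP.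
      by case/andP: u01 => /ltW.
    by case/andP: u01' => /ltW.
  have XX : X w = X w'.
    have u0 : u != 0 by case/andP: u01 => /lt0r_neq0.
    move: EE; rewrite -uu /lin => -[/addrI/(mulfI u0)/addIr e1 /addrI/(mulfI u0)/addIr e2].
    exact: plane_eq.
  have ww : w = w'.
    have [[]//|[vw' wv]] := dr_cross D rvw rvw' s01 s01' XX.
    by rewrite wv -vw'.
  by case: xyw xyw' => -[-> ->] [] [-> ->]; rewrite ww; [left|right|right|left].
- move=> w rvw; have [s01 _ _] := sP w rvw; exists (s w) => // t ts.
  rewrite /g' eqxx h_in // (h_out w (s w)) //.
- move=> x y rxy xv; rewrite /g' (negbTE xv); have [yv|yv] := eqVneq y v; last first.
    by exists (1 / 2) => //; lra.
  have rvx : r v x by rewrite -rvC -yv.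
  have [/andP[s0 s1] _ _] := sP x rvx; exists (1 - s x); first by lra.
  move=> t /andP[t0 ts]; rewrite h_out //; last by lra.
  by rewrite yv [RHS](dr_rev D).
Qed.

End Straighten.

(** * Contracting an edge of a drawing *)

(** The vertex type is kept: [a] becomes the merged vertex and [b] loses all its edges. *)
Definition contraction (V : finType) (r : rel V) (a b : V) : rel V := fun x y =>
  [&& x != y, x != b, y != b & [|| r x y, (x == a) && r b y | (y == a) && r x b]].

Section Contract.
Variables (R : realType) (V : finType) (S : {set V}) (r : rel V).
Local Notation P := (R * R)%type.
Variables (p : V -> P) (a b : V).

(** The drawing is made radial at [a], then at [b]. The path follows the edge through [W], the
    complement of the vertices and the other edges, and runs on the radii themselves near both
    ends. *)
Lemma tame_edge (g : V -> V -> R -> P) : drawing S r p g -> r a b ->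
  exists g' A, [/\ drawing S r p g', tame (p a) A (p b),
    forall z, z \in S -> A (p z) -> z = a \/ z = b &
    forall x y t, r x y -> x != a \/ y != b -> x != b \/ y != a ->
      0 <= t <= 1 -> A (g' x y t) -> exists2 z, z \in S & g' x y t = p z].
Proof.
move=> D0 rab; have [aS bS ab] := dr_mem D0 rab.
have [g1 [D1 /(_ b rab)[s s01 g1s] _]] := straighten D0 aS.
have [g2 [D2 g2b /(_ a b rab ab)[t0 t001 g2t0]]] := straighten D1 bS.
have rba : r b a by rewrite (dr_sym D2).
have {g2b} [s' s'01 g2s'] := g2b a rba.
pose W : set P := [set z | (forall v, v \in S -> z <> p v) /\
  forall x y t, r x y -> x != a \/ y != b -> x != b \/ y != a ->
    0 <= t <= 1 -> z <> g2 x y t].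
have cW t : 0 < t < 1 -> exists2 d, 0 < d &
    forall z, sqdist (g2 a b t) z < d -> W z.
  move=> t01.
  have [||d1 d10 dv] := @fin_gap R V
    (fun z d => z \in S -> d <= sqdist (g2 a b t) (p z)).
  - by move=> z d d' _ d'd dz zS; apply: le_trans d'd (dz zS).
  - move=> z; have [zS|//] := boolP (z \in S); last by exists 1.
    exists (sqdist (g2 a b t) (p z)) => //.
    by apply: sqdist_gt0; apply: (dr_vertex D2).
  have [||d2 d20 de] := @fin_gap R (V * V)%type (fun e d => r e.1 e.2 ->
    e.1 != a \/ e.2 != b -> e.1 != b \/ e.2 != a ->
    forall u, 0 <= u <= 1 -> d <= sqdist (g2 a b t) (g2 e.1 e.2 u)).
  - by move=> e d d' _ d'd de re e1 e2 u u01; apply: le_trans d'd (de re e1 e2 u u01).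
  - move=> [x y] /=; have [rxy|] := boolP (r x y); last by exists 1.
    have [E|nE] := pselect ((x != a \/ y != b) /\ (x != b \/ y != a)); last first.
      by exists 1 => // _ e1 e2; case: nE.
    have [|d d0 dg] := @curve_gap R (g2 x y) (g2 a b t) (dr_cont D2 rxy).
      move=> u /andP[u0 u1] gE.
      have [u00|un0] := eqVneq u 0.
        have [xS _ _] := dr_mem D2 rxy.
        by apply: (dr_vertex D2 rab t01 xS); rewrite -gE u00 (dr_start D2).
      have [u11|un1] := eqVneq u 1.
        have [_ yS _] := dr_mem D2 rxy.
        by apply: (dr_vertex D2 rab t01 yS); rewrite -gE u11 (dr_end D2).
      have u01 : 0 < u < 1 by rewrite !lt_neqAle eq_sym un0 u0 un1.
      have [[ax by_]|[ay bx]] := dr_cross D2 rab rxy t01 u01 (esym gE).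
        by case: E => -[]; rewrite ?ax ?by_ eqxx.
      by case: E => _ []; rewrite ?ay ?bx eqxx.
    by exists d.
  exists (Num.min d1 d2) => [|z]; first by rewrite lt_min d10.
  rewrite lt_min => /andP[zd1 zd2]; split=> [v vS zv|x y u rxy e1 e2 u01 zg].
    by move: zd1; rewrite zv ltNge dv.
  by move: zd2; rewrite zg ltNge (de (x, y)).
have inW t : 0 < t < 1 -> W (g2 a b t).
  by move=> /cW[d d0]; apply; rewrite sqdistxx.
(* Up to [t0] the second straightening changed nothing, and up to [s] the first made the edge a
   radius; so it is straight on [[0, t2]]. *)
pose t2 := Num.min t0 s.
have t20 : 0 < t2 by rewrite lt_min; case/andP: t001 => ->; case/andP: s01.
have t2t0 : t2 <= t0 by rewrite ge_min lexx.
have t2s : t2 <= s by rewrite ge_min lexx orbT.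
have [A1 tA1 A1W] : exists2 A, tame (p a) A (g2 a b (1 - s')) & A `<=` p a |` W.
  apply: (@tame_along R (p a) W (g2 a b) t2) => //.
  - exact: dr_cont D2 _ _ rab.
  - by lra.
  - by lra.
  move=> z [u /andP[u0 u1] ->].
  have ut2 : 0 <= u * t2 <= t2.
    by rewrite mulr_ge0 ?(ltW t20) //= ler_piMl // ltW.
  have -> : lin (p a) (g2 a b t2) u = g2 a b (u * t2).
    rewrite !g2t0; [|by lra|by lra].
    rewrite !(g1s (_ * _)) ?(g1s t2); [|by lra|by lra].
    by apply: plane_eq; rewrite /lin /=; ring.
  have [u00|un0] := eqVneq u 0; first by left; rewrite u00 mul0r (dr_start D2).
  have {}u0 : 0 < u by rewrite lt_neqAle eq_sym un0.
  by right; apply: inW; rewrite mulr_gt0 //=; lra.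
(* From parameter [1 - s'] on, the edge is a radius at [b], so the added segment stays on it. *)
have [A tA AA1] := tame_extend (p b) tA1.
have AW z : A z -> z = p a \/ z = p b \/ W z.
  move=> /AA1[/A1W[->|]|[u /andP[u0 u1] ->]]; [by left|by right; right|right].
  have -> : lin (g2 a b (1 - s')) (p b) u = g2 b a ((1 - u) * s').
    rewrite -(dr_rev D2) // (g2s' ((1 - u) * s')); last first.
      by rewrite mulr_ge0 ?ler_piMl //; lra.
    rewrite mulfK; last by lra.
    by apply: plane_eq; rewrite /lin /=; ring.
  have [u11|un1] := eqVneq u 1; first by left; rewrite u11 subrr mul0r (dr_start D2).
  have {}u1 : u < 1 by rewrite lt_neqAle un1.
  right; rewrite (dr_rev D2) //; apply: inW.
  have : 0 < (1 - u) * s' by rewrite mulr_gt0 //; lra.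
  have : (1 - u) * s' <= s' by rewrite ler_piMl //; lra.
  by lra.
exists g2, A; split=> //.
  move=> z zS /AW[/(dr_inj D2 zS aS)|[/(dr_inj D2 zS bS)|[/(_ z zS)//]]]; by [left|right].
move=> x y t rxy e1 e2 t01 /AW[->|[->|[_ /(_ x y t rxy e1 e2 t01)//]]]; first by exists a.
by exists b.
Qed.

(** The drawing is composed with the collapse [F] of [A], which is injective off [A]; the remaining
    edges meet [A] in [p a] and [p b] at most. *)
Lemma drawing_contraction (g : V -> V -> R -> P) : drawing S r p g -> r a b ->
  exists (p' : V -> P) (g' : V -> V -> R -> P),
    drawing (S :\ b) (contraction r a b) p' g'.
Proof.
move=> D0 rab.
have [g2 [A [D2 tA Av Ae]]] := tame_edge D0 rab.
have [F [cF iF FA]] := tame_collapse tA.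
have Aa := tame_start tA; have Ab := tame_end tA.
have [aS bS ab] := dr_mem D2 rab.
(* [o x y] is the end at [x] of the old edge drawn as the new edge [x y] *)
pose o x y := if (x == a) && ~~ r a y then b else x.
have oK x y : x != b -> (if o x y == b then a else o x y) = x.
  rewrite /o; have [/andP[/eqP-> _]|_ /negbTE->//] := boolP (_ && _).
  by rewrite eqxx.
have Fo x y : F (p (o x y)) = F (p x).
  by rewrite /o; case: ifP => [/andP[/eqP-> _]|//]; rewrite FA.
have old x y : contraction r a b x y -> [/\ r (o x y) (o y x),
    o x y != a \/ o y x != b & o x y != b \/ o y x != a].
  move=> /and4P[xy xb yb]; rewrite /o.
  have [xa|xa] := eqVneq x a; have [ya|ya] := eqVneq y a => /=.
  - by rewrite xa ya eqxx in xy.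
  - rewrite xa orbF /= => rr; case: ifP => [/negP nr|/negbFE rr'].
      by split; [case/orP: rr => // /nr|left; rewrite eq_sym|right].
    by split=> //; right.
  - rewrite ya /= => rr; case: ifP => [/negP nr|/negbFE rr'].
      split; [case/orP: rr => // rr|by left|by right; rewrite eq_sym].
      by case: nr; rewrite (dr_sym D2).
    by split; [rewrite (dr_sym D2)|left|left].
  - by rewrite orbF => rr; split=> //; left.
pose g' x y t := F (g2 (o x y) (o y x) t).
have AeS x y t : contraction r a b x y -> 0 <= t <= 1 ->
    A (g2 (o x y) (o y x) t) -> exists2 z, z \in S & g2 (o x y) (o y x) t = p z.
  by move=> /old[rr e1 e2]; exact: Ae.
have AeI x y t : contraction r a b x y -> 0 < t < 1 ->
    ~ A (g2 (o x y) (o y x) t).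
  move=> cxy t01 Ag; have [rr _ _] := old _ _ cxy.
  have [|z zS] := AeS x y t cxy _ Ag; first by lra.
  exact: (dr_vertex D2).
exists (F \o p), g'; split.
- move=> x y; rewrite !inE => /andP[xb xS] /andP[yb yS] /= /iF[|[]].
    exact: (dr_inj D2).
  by move=> /(Av x xS)[->|/eqP]; rewrite ?(negbTE xb) // => /(Av y yS)[->|/eqP];
    rewrite ?(negbTE yb).
- move=> x y; rewrite /contraction (eq_sym x y) !(dr_sym D2 x) (dr_sym D2 y b).
  by case: (x == b) (y == b) (r y x) (x == a) (y == a) => [] [] [] [] [] //=;
    rewrite orbC.
- move=> x y cxy; have /and4P[xy xb yb _] := cxy.
  have [rr _ _] := old _ _ cxy; have [oS oS' _] := dr_mem D2 rr.
  have inS z w : z != b -> o z w \in S -> z \in S.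
    by move=> zb; rewrite -{2}(oK z w zb); case: ifP.
  by rewrite !inE xb yb xy (inS x y) // (inS y x).
- move=> x y /old[rr _ _]; exact: cont_comp (dr_cont D2 rr) cF.
- move=> x y s t cxy s01 t01; have [rr e1 e2] := old _ _ cxy.
  move=> /iF[|[As At]]; first exact: (dr_arc D2).
  (* Both points are then vertices among [a] and [b]. As the edge is not [ab], they are the same
     end. *)
  have [z zS zE] := AeS x y s cxy s01 As.
  have [w wS wE] := AeS x y t cxy t01 At.
  rewrite zE in As; rewrite wE in At.
  have [_ _ oo] := dr_mem D2 rr.
  move: (Av z zS As) (Av w wS At) e1 e2 oo.
  have [[-> ->]|[-> ->]] := dr_ends D2 rr s01 zS zE;
  have [[-> ->]|[-> ->]] := dr_ends D2 rr t01 wS wE => //;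
  by move=> [->|->] [->|->]; rewrite !eqxx => -[] // _ [].
- by move=> x y /old[rr _ _]; rewrite /g' (dr_start D2) //= Fo.
- by move=> x y t /old[rr _ _]; rewrite /g' (dr_rev D2).
- move=> x y t z cxy t01; rewrite !inE => /andP[zb zS] /= /iF[|[/(AeI x y t cxy t01)//]].
  by apply: (dr_vertex D2) => //; have [] := old _ _ cxy.
- move=> x y x' y' s t cxy cxy' s01 t01 /iF[|[/(AeI x y s cxy s01)//]].
  have [rr _ _] := old _ _ cxy; have [rr' _ _] := old _ _ cxy'.
  have /and4P[_ xb yb _] := cxy; have /and4P[_ xb' yb' _] := cxy'.
  have ex := oK x y xb; have ey := oK y x yb.
  move=> /(dr_cross D2 rr rr' s01 t01)[[E1 E2]|[E1 E2]]; [left|right];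
    by rewrite E1 oK // in ex; rewrite E2 oK // in ey.
Qed.

End Contract.

Lemma connect_map (T T' : finType) (e : rel T) (e' : rel T') (f : T -> T') x y :
  (forall z w, e z w -> connect e' (f z) (f w)) ->
  connect e x y -> connect e' (f x) (f y).
Proof.
move=> ef /connectP[s + ->]; elim: s x => [|z s IH] x /=; first by rewrite connect0.
by move=> /andP[/ef xz /IH]; exact: connect_trans.
Qed.

Lemma contraction_map (V : finType) (r : rel V) (a b z w : V) :
  let f x := if x == b then a else x in
  a != b -> r z w -> f z != f w -> contraction r a b (f z) (f w).
Proof.
move=> f ab rzw fzw; rewrite /contraction fzw /f.
have fb x : (if x == b then a else x) != b by case: ifPn.
rewrite !fb /=; move: fzw; rewrite /f.
have [zb|zb] := eqVneq z b; have [wb|wb] := eqVneq w b; rewrite ?eqxx //= => _.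
- by rewrite -zb rzw orbT.
- by rewrite -wb rzw !orbT.
- by rewrite rzw.
Qed.

(** * From planarity to drawings *)

(** Extends a curve on [[0, 1]] by constants, since [planar] gives continuity on that interval
    only. *)
Definition clip (R : realType) (t : R) : R := Num.max 0 (Num.min 1 t).

Lemma clip_id (R : realType) (t : R) : 0 <= t <= 1 -> clip t = t.
Proof. by move=> /andP[t0 t1]; rewrite /clip (min_idPr t1) (max_idPr t0). Qed.

Lemma clip_in (R : realType) (t : R) : 0 <= clip t <= 1.
Proof. by rewrite /clip le_max lexx /= ge_max ler01 ge_min lexx. Qed.

Lemma cont_clip (R : realType) (T : topologicalType) (c : R -> T) :
  {within `[0, 1], continuous c} -> continuous (fun t => c (clip t)).
Proof.
move=> /subspace_continuousP cc t.
have cin s : `[0, 1]%classic (clip s : R) by rewrite /= in_itv /= clip_in.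
apply: (@cvg_comp _ _ _ (@clip R) c _ _ _ _ (cc _ (cin t))) => U /= tU.
have ccl : continuous (@clip R).
  apply: cont_max; first by move=> ?; exact: cvg_cst.
  by apply: cont_min; [move=> ?; exact: cvg_cst|exact: cont_id].
have H : nbhs t (@clip R @^-1` [set x | `[0, 1]%classic x -> U x]) := ccl t _ tU.
suff : nbhs t (@clip R @^-1` U) by [].
by apply: filterS H => s; apply; exact: cin.
Qed.

(** [planar] provides unrelated curves for the two directions of an edge. The one increasing in
    [enum_rank] is kept, and reversed for the other direction. *)
Lemma planar_drawing (V : finType) (r : rel V) : symmetric r -> planar r ->
  exists (p : V -> RR * RR) (g : V -> V -> RR -> RR * RR), drawing [set: V]%SET r p g.
Proof.
move=> rC [p [g [pI ge gx]]].
pose g' (x y : V) (t : RR) : RR * RR := if (enum_rank x < enum_rank y)%N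
  then g x y (clip t) else g y x (clip (1 - t)).
(* A loop would be an arc with equal ends, against injectivity. *)
have rxx x y : r x y -> x != y.
  move=> rxy; apply/eqP => xy; have [[_ gI] g0 g1 _] := ge x y rxy.
  have : (0 : RR) = 1 by apply: gI; rewrite ?lexx ?ler01 // g0 g1 xy.
  by move=> /eqP; rewrite eq_sym oner_eq0.
have g'E x y : r x y -> exists x0 y0 (f : RR -> RR),
    [/\ r x0 y0, x0 = x /\ y0 = y /\ (forall t, f t = t) \/
        x0 = y /\ y0 = x /\ (forall t, f t = 1 - t)
      & forall t, g' x y t = g x0 y0 (clip (f t))].
  move=> rxy; rewrite /g'; case: (enum_rank x < enum_rank y)%N.
    by exists x, y, (fun t => t); split=> //; left.
  by exists y, x, (fun t => 1 - t); split=> //; [rewrite rC|right].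
have cE x y : r x y -> exists x0 y0 (f : RR -> RR),
    [/\ r x0 y0, x0 = x /\ y0 = y \/ x0 = y /\ y0 = x,
        forall t, 0 < t < 1 -> 0 < f t < 1
      & forall t, 0 <= t <= 1 -> g' x y t = g x0 y0 (f t)].
  move=> /g'E[x0 [y0 [f [rr h E]]]]; exists x0, y0, f; split=> //.
  - by case: h => [[? [? _]]|[? [? _]]]; [left|right].
  - by move=> t t01; case: h => [[_ [_ ->]]|[_ [_ ->]]] //; lra.
  - by move=> t t01; rewrite E clip_id //; case: h => [[_ [_ ->]]|[_ [_ ->]]] //; lra.
exists p, g'; split.
- by move=> x y _ _; exact: pI.
- exact: rC.
- by move=> x y rxy; rewrite !inE rxx.
- move=> x y rxy; rewrite /g'; case: (enum_rank x < enum_rank y)%N.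
    by have [[gc _] _ _ _] := ge x y rxy; exact: (@cont_clip RR).
  rewrite rC in rxy; have [[gc _] _ _ _] := ge y x rxy.
  have c1 : continuous (fun t : RR => 1 - t) by solve_cont.
  exact: cont_comp c1 (@cont_clip RR _ _ gc).
- move=> x y s t rxy s01 t01; rewrite /g'; case: (enum_rank x < enum_rank y)%N.
    by have [[_ gI] _ _ _] := ge x y rxy; rewrite !clip_id //; exact: gI.
  rewrite rC in rxy; have [[_ gI] _ _ _] := ge y x rxy.
  rewrite !clip_id; [|lra|lra] => E; suff : 1 - s = 1 - t by lra.
  by apply: gI E; lra.
- move=> x y rxy; rewrite /g'; case: (enum_rank x < enum_rank y)%N.
    by rewrite clip_id ?lexx ?ler01 //; have [] := ge x y rxy.
  rewrite rC in rxy; rewrite subr0 clip_id ?lexx ?ler01 //.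
  by have [] := ge y x rxy.
- move=> x y t rxy; rewrite /g'; case: (ltngtP (enum_rank x) (enum_rank y)) => //.
    by rewrite subKr.
  by move=> /val_inj/enum_rank_inj xy; move: (rxx _ _ rxy); rewrite xy eqxx.
- move=> x y t z /cE[x0 [y0 [f [rr _ f01 E]]]] t01 _; rewrite E; last by lra.
  by have [_ _ _] := ge x0 y0 rr; apply; exact: f01.
- move=> x y x' y' s t /cE[x0 [y0 [f [rr h f01 E]]]] /cE[x1 [y1 [f' [rr' h' f01' E']]]].
  move=> s01 t01; rewrite E; last by lra.
  rewrite E'; last by lra.
  move=> G; have [/eqP e|ne] := boolP ([set x0; y0]%SET == [set x1; y1]%SET); last first.
    by case: (gx _ _ _ _ rr rr' ne _ _ (f01 _ s01) (f01' _ t01) G).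
  have n0 := rxx _ _ rr; have n1 := rxx _ _ rr'.
  have : (x0 \in [set x1; y1])%SET by rewrite -e !inE eqxx.
  have : (y0 \in [set x1; y1])%SET by rewrite -e !inE eqxx orbT.
  rewrite !inE => /orP[]/eqP e1 /orP[]/eqP e2.
  + by rewrite e1 e2 eqxx in n0.
  + by case: h h' => -[? ?] [] [? ?]; subst; [right|left|left|right].
  + by case: h h' => -[? ?] [] [? ?]; subst; [left|right|right|left].
  + by rewrite e1 e2 eqxx in n0.
Qed.

(** * Planarity passes to minors *)

(** Induction on [#|S|]. A branch set with two elements contains an edge [ab], which is contracted;
    each [B v] becomes [B v :\ b], and [f] sends [b] to [a] in the same branch set. If there is no
    such set, [h] is drawn within the drawing of [r]. *)
Lemma minor_drawing (U V : finType) (h : rel U) (S : {set V}) (r : rel V)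
    (p : V -> RR * RR) (g : V -> V -> RR -> RR * RR) (B : U -> {set V}) :
  irreflexive h -> drawing S r p g ->
  (forall u, B u \subset S) -> (forall u, B u != finset.set0) ->
  (forall u v, u != v -> fintype.disjoint (mem (B u)) (mem (B v))) ->
  (forall u x y, x \in B u -> y \in B u -> connect (Defs.induced r (B u)) x y) ->
  (forall u v, h u v -> exists x y, [/\ x \in B u, y \in B v & r x y]) ->
  planar h.
Proof.
move=> hI; have [n] := ubnP #|S|.
elim: n => // n IH in S r p g B * => Sn D BS B0 Bd Bc Be.
have Bu z u v : z \in B u -> z \in B v -> u = v.
  move=> zu zv; apply/eqP; apply: contraT => /Bd; rewrite disjoint_subset.
  by move=> /fintype.subsetP/(_ z zu); rewrite inE zv.
have [/existsP[u /card_gt1P[a [y [au yu ay]]]]|small] :=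
    boolP [exists u, 1 < #|B u|]%N.
  have /connectP[[|b s] /=] := Bc u a y au yu.
    by move=> _ ya; rewrite ya eqxx in ay.
  move=> /andP[/and3P[rab _ bu] _] _.
  have [_ bS ab] := dr_mem D rab.
  have [p' [g' D']] := drawing_contraction D rab.
  pose f x := if x == b then a else x.
  have fB z v : z \in B v -> f z \in B v :\ b.
    move=> zv; rewrite !inE /f; have [zb|->//] := eqVneq z b.
    by rewrite ab /= (Bu b v u) // -zb.
  apply: (IH _ _ _ _ (fun v => B v :\ b) _ D').
  - by move: Sn; rewrite (cardsD1 b) bS add1n ltnS.
  - by move=> v; apply: finset.setSD.
  - by move=> v; have /set0Pn[z /fB zv] := B0 v; apply/set0Pn; exists (f z).
  - move=> v w /Bd; apply: disjointW; exact: subsetDl.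
  - move=> v x y0; rewrite !inE => /andP[xb xv] /andP[yb yv].
    have -> : x = f x by rewrite /f (negbTE xb).
    have -> : y0 = f y0 by rewrite /f (negbTE yb).
    apply: connect_map (Bc v x y0 xv yv) => z w /and3P[rzw zv wv].
    have [->|fzw] := eqVneq (f z) (f w); first exact: connect0.
    by apply: connect1; rewrite /Defs.induced !fB // contraction_map.
  - move=> v w hvw; have [x [z [xv zw rxz]]] := Be v w hvw.
    exists (f x), (f z); rewrite !fB //; split=> //.
    (* [f x] is in [B v] and [f z] in [B w]; equality would give [v = w], against irreflexivity of
       [h]. *)
    apply: contraction_map => //; apply/eqP => fxz.
    have fE : f x = f z := fxz.
    have := fB _ _ xv; rewrite fE inE => /andP[_] /Bu vE.
    have := fB _ _ zw; rewrite inE => /andP[_] /vE vw.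
    by rewrite vw hI in hvw.
have B1 u x y : x \in B u -> y \in B u -> x = y.
  move=> xu yu; apply/eqP; apply: contraR small => xy; apply/existsP; exists u.
  by apply/card_gt1P; exists x, y.
have /choice[q qB] : forall u, exists x, x \in B u.
  by move=> u; exact/set0Pn.
have qS u : q u \in S by apply: (fintype.subsetP (BS u)).
have qI : injective q by move=> u v E; apply: (Bu (q u)) => //; rewrite E.
have hr u v : h u v -> r (q u) (q v).
  by move=> /Be[x [y [xu yv]]]; rewrite (B1 u x (q u)) // (B1 v y (q v)).
exists (p \o q), (fun u v => g (q u) (q v)); split.
- by move=> u v /(dr_inj D (qS u) (qS v))/qI.
- move=> u v /hr ruv; split.
  + split; last by move=> s t; exact: (dr_arc D).
    exact/continuous_subspaceT/(dr_cont D).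
  + exact: (dr_start D).
  + exact: (dr_end D).
  + by move=> t t01 z; exact: (dr_vertex D).
- move=> u v u' v' /hr ruv /hr ruv' uv s t s01 t01 E; case/negP: uv.
  have [[/qI-> /qI->]//|[/qI-> /qI->]] := dr_cross D ruv ruv' s01 t01 E.
  by rewrite finset.setUC.
Qed.

Lemma planar_minor (U V : finType) (h : rel U) (r : rel V) :
  irreflexive h -> symmetric r -> is_minor h r -> planar r -> planar h.
Proof.
move=> hI rC [B [B0 Bd Bc Be]] /(planar_drawing rC)[p [g D]].
by apply: (minor_drawing hI D) B0 Bd Bc Be => u; exact: finset.subsetT.
Qed.

End PlaneDrawing.

(** * Non-planarity of token graphs *)

Theorem theorem5 (T U : finType) (e : rel T) (h : rel U) :
  symmetric e -> irreflexive e -> symmetric h -> irreflexive h ->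
  is_minor h e ->
  4 <= #|U| ->
  (forall j : nat, 2 <= j <= #|U| - 2 -> ~ planar (token_graph h j)) ->
  forall k : nat, 2 <= k <= #|T| - 2 -> ~ planar (token_graph e k).
Proof.
move=> eC _ hC _ he U4 Hplanar k kT ek; have [j jU hj] := minor_token hC he U4 kT.
apply: (Hplanar j jU); apply: PlaneDrawing.planar_minor hj ek.
  exact: token_graph_irr.
exact: token_graph_sym.
Qed.
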